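(* Let $s\ge2$ be an integer. $I_s^\infty$ is closed under the smooth functional calculus of self-adjoint elements: for any self-adjoint $c\in I_s^\infty$ and any smooth function $f$ on a neighborhood of the spectrum of $c$ with $f(0)=0$, we have $f(c)\in I_s^\infty$.
   Context: $\mathbb{Z}_s$ is the compact ring of $s$-adic integers $x=\sum_{j\ge0}x_js^j$, $0\le x_j\le s-1$ (i.e. $\varprojlim\mathbb{Z}/s^n\mathbb{Z}$), and $\mathbb{Z}_s^\times=\{x\in\mathbb{Z}_s: x_0\ne0\}$ (a clopen subset; the elements of $s$-adic norm $1$). $H=\ell^2(\mathbb{Z})$ has canonical basis $\{E_l\}_{l\in\mathbb{Z}}$; $VE_l=E_{sl}$ and $M_fE_l=f(l)E_l$ for $f\in C(\mathbb{Z}_s)$. $HS(s)\subseteq B(H)$ is the C$^*$-algebra generated by $V$ and all $M_f$, $f\in C(\mathbb{Z}_s)$. Every nonzero $l\in\mathbb{Z}$ is written uniquely as $l=s^ml'$ with $m\ge0$, $s\nmid l'$. For $F\in C_0(\mathbb{Z}_{\ge0}\times\mathbb{Z}_s^\times)$ put $M_FE_{s^ml'}=F(m,l')E_{s^ml'}$, $M_FE_0=0$. RD (rapid decay) means decaying faster than any inverse polynomial in the indices. $I_s^\infty\subseteq HS(s)$ is the set of norm-convergent sums $a=\sum_{n\ge0}V^nM_{F_n}+\sum_{n<0}M_{F_n}(V^* )^{-n}$ with $F_n\in C_0(\mathbb{Z}_{\ge0}\times\mathbb{Z}_s^\times)$ and $\{\sup_x|F_n(m,x)|\}_{m,n}$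 RD in $(m,n)$. The spectrum is taken in $HS(s)$ (a subset of $\mathbb{R}$ for self-adjoint $c$), and $f(c)$ is the continuous functional calculus in $HS(s)$. *)

(* Defs.v *)
From HB Require Import structures.
From mathcomp Require Import all_boot all_order all_algebra.
From mathcomp Require Import all_classical all_reals all_analysis.
From mathcomp Require Import complex.
From mathcomp Require Import ring.

Set Implicit Arguments.
Unset Strict Implicit.
Unset Printing Implicit Defensive.

Import Order.TTheory GRing.Theory Num.Theory numFieldNormedType.Exports.
Import Normc.

Local Open Scope classical_set_scope.
Local Open Scope ring_scope.
Local Open Scope complex_scope.

(* R[i] carries its topology only through the alias R[i]^o; this is why limits
   and continuity of complex-valued functions are annotated with ^o below. *)

Section l2_space.
Variable R : realType.
Local Notation C := R[i].

Definition sqsum (x : int -> C) : \bar R :=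
  (\esum_(l in [set: int]) (normc (x l) ^+ 2)%:E)%E.

Definition square_summable : {pred int -> C} := fun x => (sqsum x < +oo)%E.

Lemma normc_sqr (z : C) :
  normc z ^+ 2 = complex.Re z ^+ 2 + complex.Im z ^+ 2.
Proof. by case: z => a b /=; rewrite sqr_sqrtr // addr_ge0 ?sqr_ge0. Qed.

Lemma normc_sqrD_le (z w : C) :
  normc (z + w) ^+ 2 <= 2 * normc z ^+ 2 + 2 * normc w ^+ 2.
Proof.
rewrite !normc_sqr; case: z => a b; case: w => c d /=; rewrite -subr_ge0.
rewrite (_ : _ - _ = (a - c) ^+ 2 + (b - d) ^+ 2); last by ring.
by rewrite addr_ge0 ?sqr_ge0.
Qed.

Lemma esumZ_le (k : R) (a : int -> R) : 0 <= k -> (forall l, 0 <= a l) ->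
  (\esum_(l in [set: int]) (k * a l)%:E <=
   k%:E * \esum_(l in [set: int]) (a l)%:E)%E.
Proof.
move=> k0 a0; apply: ge_ereal_sup => _ [X [finX XT] <-].
under eq_fsbigr do rewrite EFinM.
rewrite -ge0_mule_fsumr; last by move=> l; rewrite lee_fin.
by apply: lee_wpmul2l; [rewrite lee_fin | apply: ereal_sup_ubound; exists X].
Qed.

Lemma sqsum_fin x : x \in square_summable -> exists M : R, sqsum x = M%:E.
Proof.
rewrite -topredE /= /square_summable => xfin.
have x0 : (0 <= sqsum x)%E by apply: esum_ge0 => l _; rewrite lee_fin sqr_ge0.
by exists (fine (sqsum x)); rewrite fineK // ge0_fin_numE.
Qed.

Lemma square_summable_submod_closed : submod_closed square_summable.
Proof.
split=> [|k x y /sqsum_fin[M xM] /sqsum_fin[N yN]].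
  rewrite -topredE /= /square_summable /sqsum esum1 ?ltry // => l _.
  by rewrite normc0 expr0n.
rewrite -topredE /= /square_summable.
apply: (@le_lt_trans _ _
    ((2 * normc k ^+ 2)%:E * M%:E + 2%:E * N%:E)%E); last first.
  by rewrite -!EFinM -EFinD ltry.
rewrite -xM -yN.
apply: (@le_trans _ _ (\esum_(l in [set: int])
    ((2 * normc k ^+ 2 * normc (x l) ^+ 2)%:E +
     (2 * normc (y l) ^+ 2)%:E))%E).
  apply: le_esum => l _; rewrite -EFinD lee_fin.
  by rewrite (le_trans (normc_sqrD_le _ _)) // normcM exprMn mulrA.
have h0 (z : C) : 0 <= 2 * normc z ^+ 2.
  by apply: mulr_ge0; [exact: ler0n | exact: sqr_ge0].
have hxy l : 0 <= 2 * normc k ^+ 2 * normc (x l) ^+ 2.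
  by apply: mulr_ge0; [exact: h0 | exact: sqr_ge0].
rewrite esumD => [|l _|l _]; try by rewrite lee_fin.
by apply: leeD; apply: esumZ_le => *;
  by [exact: sqr_ge0 | exact: ler0n | exact: h0].
Qed.

HB.instance Definition _ :=
  GRing.isSubmodClosed.Build C (int -> C) square_summable
    square_summable_submod_closed.

Record l2 := L2 { l2_val :> int -> C ; _ : l2_val \in square_summable }.

HB.instance Definition _ := [isSub for l2_val].
HB.instance Definition _ := [Choice of l2 by <:].
HB.instance Definition _ := [SubChoice_isSubLmodule of l2 by <:].

(* The vector with coordinates x. The value 0 given to families x that are not
   square-summable is never used: all the operators below that are built from
   mkl2 are bounded. *)
Definition mkl2 (x : int -> C) : l2 := insubd (0 : l2) x.

Definition ebasis (l : int) : l2 := mkl2 (fun k => (k == l)%:R).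

Definition l2norm (x : l2) : R := Num.sqrt (fine (sqsum x)).

Definition sumZ (f : int -> C) : C :=
  limn (series (fun n : nat => f n%:Z : C^o)) +
  limn (series (fun n : nat => f (- (n.+1)%:Z) : C^o)).

Definition inner (x y : l2) : C := sumZ (fun l => x l * (y l)^*).

Definition bounded_op (T : l2 -> l2) : Prop :=
  linear T /\ exists M : R, forall x, l2norm (T x) <= M * l2norm x.

Definition opnorm (T : l2 -> l2) : R :=
  sup [set l2norm (T x) | x in [set x | l2norm x <= 1]].

Definition norm_cvg (T_ : nat -> l2 -> l2) (T : l2 -> l2) : Prop :=
  opnorm (T_ n - T) @[n --> \oo] --> (0 : R).

Definition is_adjoint (T S : l2 -> l2) : Prop :=
  forall x y, inner (T x) y = inner x (S y).

Record Cstar_subalgebra (A : set (l2 -> l2)) : Prop := {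
  Cstar_bounded : A `<=` bounded_op ;
  Cstar_add : forall T S, A T -> A S -> A (T + S) ;
  Cstar_scale : forall (k : C) T, A T -> A (k *: T) ;
  Cstar_comp : forall T S, A T -> A S -> A (T \o S) ;
  Cstar_adjoint : forall T S,
    A T -> bounded_op S -> is_adjoint T S -> A S ;
  Cstar_closed : forall T_ T,
    (forall n, A (T_ n)) -> bounded_op T -> norm_cvg T_ T -> A T }.

Definition Cstar_generated (G : set (l2 -> l2)) : set (l2 -> l2) :=
  \bigcap_(A in [set A | Cstar_subalgebra A /\ G `<=` A]) A.

Definition diag_op (a : int -> C) : l2 -> l2 :=
  fun x => mkl2 (fun l => a l * x l).

End l2_space.

(* The s-adic integer \sum_j x_j s^j is its sequence of digits x_j; for s >= 2,
   'Z_s is the finite set {0, .., s - 1}. *)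
Definition Zadic (s : nat) : Type :=
  prod_topology (fun _ : nat => discrete_topology 'Z_s).
HB.instance Definition _ s := Topological.on (Zadic s).

(* The j-th digit of l is floor (l / s^j) mod s, also for negative l. *)
Definition int_Zadic (s : nat) (l : int) : Zadic s :=
  fun j => ((l %/ (s ^ j)%N)%Z)%:~R.

Definition Zadic_units (s : nat) : set (Zadic s) := [set x | x 0%N != 0].

Definition vals (s : nat) (l : int) : nat :=
  \max_(m < `|l|.+1 | (s ^ m %| `|l|)%N) m.

Definition prime_part (s : nat) (l : int) : int := (l %/ (s ^ vals s l)%N)%Z.

Section Hensel_Steinitz.
Variables (R : realType) (s : nat).
Local Notation C := R[i].
Local Notation H := (l2 R).
Local Notation Zs := (Zadic s).

Definition V : H -> H := fun x =>
  mkl2 (fun k => if (s %| k)%Z then x (k %/ s)%Z else 0).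

Definition Vstar : H -> H := fun x => mkl2 (fun k => x (s%:Z * k)).

Definition Mop (f : Zs -> C) : H -> H :=
  diag_op (fun l => f (int_Zadic s l)).

Definition HS : set (H -> H) :=
  Cstar_generated
    (V |` [set Mop f | f in [set f | continuous (f : Zs -> C^o)]]).

Definition Xdom : set (nat * Zs) := [set p | Zadic_units p.2].

Definition C0 (F : nat * Zs -> C) : Prop :=
  {within Xdom, continuous (F : nat * Zs -> C^o)} /\
  forall e : R, 0 < e -> exists K : set (nat * Zs),
    [/\ compact K, K `<=` Xdom &
        forall p, Xdom p -> ~ K p -> normc (F p) < e].

Definition MFop (F : nat * Zs -> C) : H -> H :=
  diag_op (fun l =>
    if l == 0 then 0 else F (vals s l, int_Zadic s (prime_part s l))).

Definition rapid_decay (a : nat -> int -> R) : Prop :=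
  forall k : nat, exists M : R, forall m n,
    (1 + m%:R + `|n|%:~R) ^+ k * a m n <= M.

(* -(j + 1), j < N, runs over the indices -N <= n < 0. *)
Definition partial_sum (F : int -> nat * Zs -> C) (N : nat) : H -> H :=
  \sum_(j < N) (iter j V \o MFop (F j%:Z)) +
  \sum_(j < N) (MFop (F (- (j.+1)%:Z)) \o iter j.+1 Vstar).

Definition Iinf : set (H -> H) := [set a | HS a /\
  exists F : int -> nat * Zs -> C,
    [/\ forall n, C0 (F n),
        rapid_decay (fun m n =>
          sup [set normc (F n (m, x)) | x in @Zadic_units s]) &
        norm_cvg (partial_sum F) a]].

Definition spectrum (c : H -> H) : set C := [set z |
  ~ exists b, [/\ HS b, b \o (c - z *: id) = id & (c - z *: id) \o b = id]].

Definition real_spectrum (c : H -> H) : set R := [set t | spectrum c t%:C].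

(* Phi is the continuous functional calculus of the self-adjoint element c, i.e.
   the (unique) unital *-homomorphism from C(spectrum c) to HS that maps the
   identity function to c; as the spectrum of c is real, functions on it are
   represented by functions on R, up to equality on the spectrum. *)
Record is_cfc (c : H -> H) (Phi : (R -> C) -> H -> H) : Prop := {
  cfc_ext : forall g h : R -> C,
    {in real_spectrum c, g =1 h} -> Phi g = Phi h ;
  cfc_HS : forall g : R -> C,
    {within real_spectrum c, continuous (g : R -> C^o)} -> HS (Phi g) ;
  cfc_add : forall g h : R -> C,
    {within real_spectrum c, continuous (g : R -> C^o)} ->
    {within real_spectrum c, continuous (h : R -> C^o)} ->
    Phi (fun t => g t + h t) = Phi g + Phi h ;
  cfc_scale : forall (k : C) (g : R -> C),
    {within real_spectrum c, continuous (g : R -> C^o)} ->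
    Phi (fun t => k * g t) = k *: Phi g ;
  cfc_mul : forall g h : R -> C,
    {within real_spectrum c, continuous (g : R -> C^o)} ->
    {within real_spectrum c, continuous (h : R -> C^o)} ->
    Phi (fun t => g t * h t) = Phi g \o Phi h ;
  cfc_adjoint : forall g : R -> C,
    {within real_spectrum c, continuous (g : R -> C^o)} ->
    is_adjoint (Phi g) (Phi (fun t => (g t)^*)) ;
  cfc_one : Phi (fun=> 1) = id ;
  cfc_id : Phi (fun t => t%:C) = c }.

End Hensel_Steinitz.

(* Smoothness of the real and imaginary parts; on an open U the values of f
   outside U do not matter. *)
Definition smooth_on (R : realType) (U : set R) (f : R -> R[i]) : Prop :=
  forall n t, U t ->
    derivable (derive1n n (fun u => complex.Re (f u))) t 1 /\
    derivable (derive1n n (fun u => complex.Im (f u))) t 1.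

Section l2_facts.
Variable R : realType.
Local Notation C := R[i].

Lemma mkl2K (x : int -> C) :
  x \in @square_summable R -> mkl2 x = x :> (int -> C).
Proof. exact: insubdK. Qed.

Lemma sqsum_pull (e : int -> int) (x y : int -> C) :
  set_inj [set: int] e -> (forall l, y (e l) = x l) ->
  (forall k, ~ (exists l, e l = k) -> y k = 0) -> sqsum y = sqsum x.
Proof.
move=> einj ye y0.
transitivity (\esum_(k in e @` [set: int]) (normc (y k) ^+ 2)%:E)%E.
  rewrite /sqsum [RHS]esum_mkcond; apply: eq_esum => k _.
  case: ifPn => // /negP kn; rewrite y0 ?normc0 ?expr0n // => -[l lk].
  by apply: kn; rewrite inE; exists l.
by rewrite esum_image //; apply: eq_esum => l _; rewrite ye.
Qed.

Lemma delta_square_summable (l : int) (z : C) :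
  (fun k : int => z * (k == l)%:R) \in @square_summable R.
Proof.
rewrite -topredE /= /square_summable /sqsum.
rewrite (_ : esum _ _ =
    \esum_(k in [set l]) (normc (z * (k == l)%:R) ^+ 2)%:E)%E; last first.
  rewrite [RHS]esum_mkcond; apply: eq_esum => k _.
  case: ifPn => // kl; rewrite (_ : (k == l) = false) ?mulr0 ?normc0 ?expr0n //.
  by apply/negP => /eqP kl'; move/negP: kl; apply; rewrite kl' inE.
by rewrite esum_set1 ?ltry // lee_fin sqr_ge0.
Qed.

Lemma ebasisE (l k : int) : ebasis R l k = (k == l)%:R.
Proof.
rewrite mkl2K //.
rewrite (_ : (fun _ => _) = fun k : int => 1 * (k == l)%:R).
  exact: delta_square_summable.
by apply/funext => j; rewrite mul1r.
Qed.

Lemma l2P (x y : l2 R) : (forall k, x k = y k) -> x = y.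
Proof. by move=> xy; apply: val_inj; apply/funext. Qed.

Lemma diag_op_ebasis (a : int -> C) (l : int) :
  diag_op a (ebasis R l) = a l *: ebasis R l.
Proof.
rewrite -[RHS](valKd (0 : l2 R)) /diag_op /mkl2; congr insubd.
apply/funext => k; rewrite ebasisE.
change (a k * (k == l)%:R = a l * ebasis R l k); rewrite ebasisE.
by have [->//|_] := eqVneq; rewrite !mulr0.
Qed.

Variables (s : nat) (s_gt0 : (0 < s)%N).

Lemma V_ss (x : l2 R) :
  (fun k : int => if (s %| k)%Z then x (k %/ s)%Z else 0)
    \in @square_summable R.
Proof.
rewrite -topredE /= /square_summable (@sqsum_pull (fun l => s%:Z * l) x).
- by case: x.
- by move=> i j _ _ /mulfI; apply; rewrite -lt0n.
- by move=> l; rewrite dvdz_mulr // mulKz // -lt0n.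
- move=> k nk; case: ifP => // /dvdzP[q kq]; case: nk; exists q.
  by rewrite mulrC.
Qed.

Lemma V_val (x : l2 R) k :
  V s x k = if (s %| k)%Z then x (k %/ s)%Z else 0.
Proof. by rewrite mkl2K // V_ss. Qed.

Lemma V_ebasis l : V s (ebasis R l) = ebasis R (s%:Z * l).
Proof.
apply: l2P => k; rewrite V_val !ebasisE.
case: ifPn => [/dvdzP[q ->]|sk].
  by rewrite mulzK -?lt0n // mulrC (inj_eq (mulfI _)) // -lt0n.
by have [kE|//] := eqVneq; rewrite kE dvdz_mulr in sk.
Qed.

Lemma Vstar_ss (x : l2 R) :
  (fun k : int => x (s%:Z * k)) \in @square_summable R.
Proof.
have : (x : int -> C) \in @square_summable R by case: x.
rewrite -!topredE /= /square_summable; apply: le_lt_trans.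
rewrite /sqsum -(esum_image [set: int] (fun k => s%:Z * k)
  (fun l => (normc (x l) ^+ 2)%:E)).
  rewrite esum_mkcond; apply: le_esum => l _.
  by case: ifP => // _; rewrite lee_fin sqr_ge0.
by move=> i j _ _ /mulfI; apply; rewrite -lt0n.
Qed.

Lemma series_dvd (g : nat -> C^o) N :
  series (fun n => if (s %| n)%N then g (n %/ s)%N else 0) N =
  series g ((N + s.-1) %/ s)%N.
Proof.
elim: N => [|N IHN].
  by rewrite add0n divn_small ?prednK // /series /= !big_geq.
rewrite seriesSr IHN addSn divnS // -addnS prednK // dvdn_addl //.
case: ifPn => [/dvdnP[q ->]|_]; last by rewrite addr0.
by rewrite divnMDl // mulnK // divn_small ?prednK // addn0 add1n seriesSr.
Qed.

Lemma series_dvdS (g : nat -> C^o) N :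
  series (fun n => if (s %| n.+1)%N then g (n.+1 %/ s).-1 else 0) N =
  series g (N %/ s)%N.
Proof.
elim: N => [|N IHN]; first by rewrite div0n /series /= !big_geq.
rewrite seriesSr IHN divnS //.
by case: ifP => [->|_]; rewrite ?addr0 // !add1n seriesSr.
Qed.

Lemma limn_reindex (u : nat -> C^o) (h : nat -> nat) :
  {homo h : m n / (m <= n)%N} -> (forall m, h (s * m)%N = m) ->
  limn (u \o h) = limn u.
Proof.
move=> hmono hK; suff hoo : h @ \oo = \oo by rewrite -[in RHS]hoo.
apply/seteqP; split=> A [N _ NA].
  exists N => // m /= Nm; rewrite -[m]hK; apply: NA => /=.
  by rewrite (leq_trans Nm) // leq_pmull.
exists (s * N)%N => // m /= Nm; apply: NA => /=.
by rewrite -[N]hK; exact: hmono.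
Qed.

Lemma Vstar_adjoint : is_adjoint (@V R s) (@Vstar R s).
Proof.
move=> x y; rewrite /inner /sumZ; congr (_ + _).
- pose u := series (fun n : nat => x n%:Z * (Vstar s y n%:Z)^* : C^o).
  transitivity (limn (u \o (fun N => (N + s.-1) %/ s)%N)).
    apply: (congr1 (fun w : nat -> C^o => limn w)); apply/funext => N.
    rewrite /u /= -series_dvd.
    congr (series _ N); apply/funext => n; rewrite V_val.
    rewrite /Vstar mkl2K ?Vstar_ss // dvdzE /=.
    case: ifPn => [/dvdnP[q ->]|_]; last by rewrite mul0r.
    by rewrite mulnK // PoszM mulzK -?lt0n // [q%:Z * _]mulrC.
  apply: limn_reindex => [m n mn|m]; first by rewrite leq_div2r // leq_add2r.
  by rewrite mulnC divnMDl // divn_small ?prednK // addn0.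
- pose u := series (fun n : nat =>
    x (- n.+1%:Z) * (Vstar s y (- n.+1%:Z))^* : C^o).
  transitivity (limn (u \o (fun N => N %/ s)%N)).
    apply: (congr1 (fun w : nat -> C^o => limn w)); apply/funext => N.
    rewrite /u /= -series_dvdS.
    congr (series _ N); apply/funext => n; rewrite V_val.
    rewrite /Vstar mkl2K ?Vstar_ss // dvdzE /=.
    case: ifPn => [/dvdnP[[//|q] nE]|_]; last by rewrite mul0r.
    by rewrite nE mulnK //= PoszM -mulNr mulzK -?lt0n // mulrC.
  apply: limn_reindex => [m n mn|m]; first by rewrite leq_div2r.
  by rewrite mulKn.
Qed.

End l2_facts.

Lemma Mop_ebasis (R : realType) (s : nat) (f : Zadic s -> R[i]) (l : int) :
  Mop f (ebasis R l) = f (int_Zadic s l) *: ebasis R l.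
Proof. exact: diag_op_ebasis. Qed.

Lemma vals_pow (s m : nat) (l : int) : (1 < s)%N -> ~~ (s%:Z %| l)%Z ->
  vals s ((s ^ m)%N%:Z * l) = m.
Proof.
move=> s_gt1 sl.
have l0 : (0 < `|l|)%N by rewrite absz_gt0; apply: contra sl => /eqP ->.
have mN : (m < (absz ((s ^ m)%N%:Z * l)%R).+1)%N.
  rewrite ltnS abszM absz_nat (leq_trans (ltnW (ltn_expl m s_gt1))) //.
  by rewrite leq_pmulr.
apply/eqP; rewrite eqn_leq; apply/andP; split.
  apply/bigmax_leqP => -[k kN] /=; rewrite leqNgt; apply: contraL => mk.
  apply: contra sl; rewrite abszM absz_nat dvdzE /= => skl.
  rewrite -(@dvdn_pmul2l (s ^ m)) ?expn_gt0 ?(ltnW s_gt1) // -expnSr.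
  exact: dvdn_trans (dvdn_exp2l s mk) skl.
apply: (@leq_bigmax_cond _ _ (fun i => nat_of_ord i) (Ordinal mN)).
by rewrite /= abszM dvdn_mulr.
Qed.

Lemma MFop_ebasis (R : realType) (s m : nat) (F : nat * Zadic s -> R[i])
    (l : int) : (1 < s)%N -> ~~ (s%:Z %| l)%Z ->
  MFop F (ebasis R ((s ^ m)%N%:Z * l)) =
  F (m, int_Zadic s l) *: ebasis R ((s ^ m)%N%:Z * l).
Proof.
move=> s_gt1 sl; have sm0 : (s ^ m)%N%:Z != 0.
  by rewrite -lt0n expn_gt0 (ltnW s_gt1).
have l0 : l != 0 by apply: contra sl => /eqP ->.
rewrite /MFop diag_op_ebasis (negbTE (mulf_neq0 sm0 l0)).
by rewrite /prime_part vals_pow // mulKz.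
Qed.

Lemma MFop_ebasis0 (R : realType) (s : nat) (F : nat * Zadic s -> R[i]) :
  MFop F (ebasis R 0) = 0.
Proof. by rewrite /MFop diag_op_ebasis eqxx scale0r. Qed.

(* Main.v *)
(** Since f(0) = 0, f(t) = h(t) t with h continuous, so f(c) = h(c) c and, c being
    self-adjoint, f(c)^* = (conj h)(c) c. The columns c E_(s^m l) of an element c
    of I_s^oo decay rapidly in m, uniformly in l; therefore so do the columns of
    f(c) and of f(c)^*, that is, the matrix entries of f(c) decay rapidly.

    The rest holds for every element of HS(s). Its commutator with the unitary
    exchanging E_(s^m l) and E_(s^m l') for all m is small when l and l' are
    s-adically close: this is clear for V and, by uniform continuity, for M_f, and
    passes to the C*-algebra that they generate. Hence the matrix entries depend
    continuously on l and extend to s-adic units. In the same way, commutation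
    with the sign change on one orbit {s^m l} shows that HS(s) preserves orbits. *)

Require Import Defs.
From mathcomp Require Import all_boot all_order all_algebra.
From mathcomp Require Import all_classical all_reals all_analysis.
From mathcomp Require Import complex.
From mathcomp Require Import ring lra.

Set Implicit Arguments.
Unset Strict Implicit.
Unset Printing Implicit Defensive.

Import Order.TTheory GRing.Theory Num.Theory numFieldNormedType.Exports.
Import Normc.

Local Open Scope classical_set_scope.
Local Open Scope ring_scope.
Local Open Scope complex_scope.

(** * The norm of l2 *)

Section box_sums.
Variable R : realType.
Local Notation C := R[i].

(** The diagonals of h(c) need not decay at all, so the definition of [Iinf] cannot be followed
    through the product h(c) c. What survives is a bound on column norms, because a bounded left
    factor changes them by a constant only. Such a bound controls an entry through its column index;
    the row index is reached through the columns of the adjoint, and on the n-th diagonal the larger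
    of the two indices is exactly m + |n|, the weight of rapid decay. Small commutators are the
    right form of continuity because they pass to products, adjoints and norm limits, and because an
    operator bound applied to basis vectors is uniform in all entries of an orbit at once. The
    reconstructed series is shown to converge to f(c) in two steps: coordinate by coordinate, which
    uses the preservation of orbits, and then in norm by a Cauchy estimate of order 1/N. *)

Definition box_sum (V : nmodType) (g : int -> V) (N : nat) : V :=
  \sum_(0 <= n < N) g n%:Z + \sum_(0 <= n < N) g (- n.+1%:Z).

Lemma box_sumD (V : nmodType) (g h : int -> V) N :
  box_sum (fun l => g l + h l) N = box_sum g N + box_sum h N.
Proof. by rewrite /box_sum !big_split /= addrACA. Qed.

Lemma box_sumZ (K : pzRingType) (k : K) (g : int -> K) N :
  box_sum (fun l => k * g l) N = k * box_sum g N.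
Proof. by rewrite /box_sum -!mulr_sumr mulrDr. Qed.

Lemma ler_box_sum (g h : int -> R) N :
  (forall l, g l <= h l) -> box_sum g N <= box_sum h N.
Proof. by move=> gh; rewrite lerD // ler_sum. Qed.

Lemma nondecreasing_box_sum (g : int -> R) : (forall l, 0 <= g l) ->
  {homo box_sum g : m n / (m <= n)%N >-> m <= n}.
Proof.
by move=> g0 m n mn; rewrite lerD // !(big_cat_nat (leq0n m) mn) /=
  lerDl sumr_ge0.
Qed.

Lemma esum_int (g : int -> R) : (forall l, 0 <= g l) ->
  (\esum_(l in [set: int]) (g l)%:E =
   \sum_(0 <= n <oo) (g n%:Z)%:E + \sum_(0 <= n <oo) (g (- n.+1%:Z))%:E)%E.
Proof.
move=> g0.
rewrite (esumID [set l : int | 0 <= l]) => [|l _]; last by rewrite lee_fin.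
rewrite !nneseries_esum => [|n _|n _]; try by rewrite lee_fin.
congr (_ + _)%E.
  rewrite (_ : _ `&` _ = Posz @` [set: nat]); last first.
    rewrite setTI; apply/seteqP; split=> [[n|n] //= _|_ [n _ <-]//].
    by exists n.
  rewrite esum_image => [|m n _ _ []//].
  by congr esum; apply/seteqP.
rewrite (_ : _ `&` _ = (fun n : nat => - n.+1%:Z) @` [set: nat]); last first.
  rewrite setTI; apply/seteqP; split=> [[n|n] //= H|_ [n _ <-]//].
  by exists n.
rewrite esum_image => [|m n _ _ /oppr_inj []//].
by congr esum; apply/seteqP.
Qed.

(** Links the unordered sums behind [sqsum] to finite sums over -N <= l < N, on which inequalities
    are plain real arithmetic. *)
Lemma cvg_box_esum (g : int -> R) : (forall l, 0 <= g l) ->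
  (box_sum g N)%:E @[N --> \oo] --> (\esum_(l in [set: int]) (g l)%:E)%E.
Proof.
move=> g0; rewrite esum_int//.
under eq_fun do rewrite /box_sum EFinD -!sumEFin.
apply: cvgeD; last 2 first.
- by apply: is_cvg_nneseries => n _ _; rewrite lee_fin.
- by apply: is_cvg_nneseries => n _ _; rewrite lee_fin.
by rewrite ge0_adde_def// inE nneseries_ge0// => n _ _; rewrite lee_fin.
Qed.

Lemma box_le_esum (g : int -> R) N : (forall l, 0 <= g l) ->
  ((box_sum g N)%:E <= \esum_(l in [set: int]) (g l)%:E)%E.
Proof.
move=> g0; rewrite -(cvg_lim _ (cvg_box_esum g0))//.
apply: lime_ge; first exact: (cvgP _ (cvg_box_esum g0)).
by exists N => // n /= Nn; rewrite lee_fin nondecreasing_box_sum.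
Qed.

Lemma esum_le_box (g : int -> R) (M : R) : (forall l, 0 <= g l) ->
  (forall N, box_sum g N <= M) ->
  (\esum_(l in [set: int]) (g l)%:E <= M%:E)%E.
Proof.
move=> g0 gM; rewrite -(cvg_lim _ (cvg_box_esum g0))//.
apply: lime_le; first exact: (cvgP _ (cvg_box_esum g0)).
by apply: nearW => n; rewrite lee_fin.
Qed.

End box_sums.

Section l2norm.
Variable R : realType.
Local Notation C := R[i].
Implicit Types (x y z : l2 R) (k : int).

Lemma l2_ss x : (x : int -> C) \in @square_summable R.
Proof. by case: x. Qed.

Lemma l2norm_ge0 x : 0 <= l2norm x. Proof. exact: sqrtr_ge0. Qed.

Lemma sqsumE x : sqsum x = (l2norm x ^+ 2)%:E.
Proof.
have [M xM] := sqsum_fin (l2_ss x).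
have M0 : 0 <= M.
  by rewrite -lee_fin -xM esum_ge0// => l _; rewrite lee_fin sqr_ge0.
by rewrite /l2norm xM /= sqr_sqrtr.
Qed.

Lemma cvg_box_l2norm x :
  box_sum (fun l => normc (x l) ^+ 2) N @[N --> \oo] --> l2norm x ^+ 2.
Proof.
by have := @cvg_box_esum R (fun l => normc (x l) ^+ 2)
  (fun l => sqr_ge0 _); rewrite -[esum _ _]/(sqsum x) sqsumE => /fine_cvgP[_].
Qed.

Lemma box_le_l2norm x N :
  box_sum (fun l => normc (x l) ^+ 2) N <= l2norm x ^+ 2.
Proof.
rewrite -lee_fin -sqsumE; apply: (box_le_esum (g := fun l => normc (x l) ^+ 2)).
by move=> l; exact: sqr_ge0.
Qed.

Lemma l2norm_le_box x (M : R) : 0 <= M ->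
  (forall N, box_sum (fun l => normc (x l) ^+ 2) N <= M ^+ 2) -> l2norm x <= M.
Proof.
move=> M0 xM; rewrite -(@ler_pXn2r _ 2) ?nnegrE ?l2norm_ge0//.
by rewrite -lee_fin -sqsumE; apply: esum_le_box => // l; exact: sqr_ge0.
Qed.

Lemma ss_le (a : int -> C) (M : R) :
  (forall N, box_sum (fun l => normc (a l) ^+ 2) N <= M) ->
  a \in @square_summable R.
Proof.
move=> aM; rewrite -topredE /= /square_summable.
apply: le_lt_trans (ltry M); apply: esum_le_box => // l; exact: sqr_ge0.
Qed.

Lemma normc_ge0 (z : C) : 0 <= normc z.
Proof. by case: z => a b /=; exact: sqrtr_ge0. Qed.

Lemma sqr_normc_le_box (a : int -> C) k :
  normc (a k) ^+ 2 <= box_sum (fun l => normc (a l) ^+ 2) (`|k|%N).+1.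
Proof.
have H (u : nat -> R) n N : (forall m, 0 <= u m) -> (n < N)%N ->
    u n <= \sum_(0 <= m < N) u m.
  move=> u0 nN; rewrite (bigD1_seq n) ?mem_index_iota ?iota_uniq//=.
  by rewrite lerDl sumr_ge0.
case: k => n; rewrite /box_sum /=.
  apply: ler_wpDr; first by rewrite sumr_ge0// => *; exact: sqr_ge0.
  by apply: (H (fun n => normc (a n%:Z) ^+ 2)) => // m; exact: sqr_ge0.
apply: ler_wpDl; first by rewrite sumr_ge0// => *; exact: sqr_ge0.
rewrite NegzE.
by apply: (H (fun n => normc (a (- n.+1%:Z)) ^+ 2)) => // m; exact: sqr_ge0.
Qed.

Lemma coord_le_l2norm x k : normc (x k) <= l2norm x.
Proof.
rewrite -(@ler_pXn2r _ 2) ?nnegrE ?l2norm_ge0 ?normc_ge0//.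
exact: le_trans (sqr_normc_le_box x k) (box_le_l2norm _ _).
Qed.

Lemma l2norm0_eq0 x : l2norm x = 0 -> x = 0.
Proof.
move=> x0; apply: l2P => k; apply: eq0_normc; apply/le_anti.
by rewrite normc_ge0 -x0 coord_le_l2norm.
Qed.

Lemma ler_l2norm x y : (forall k, normc (x k) <= normc (y k)) ->
  l2norm x <= l2norm y.
Proof.
move=> xy; apply: l2norm_le_box => [|N]; first exact: l2norm_ge0.
apply: le_trans (box_le_l2norm y N); apply: ler_box_sum => l.
by rewrite ler_pXn2r ?nnegrE ?normc_ge0.
Qed.

Lemma l2D_val x y k : (x + y) k = x k + y k. Proof. by []. Qed.
Lemma l2N_val x k : (- x) k = - x k. Proof. by []. Qed.
Lemma l2Z_val (a : C) x k : (a *: x) k = a * x k. Proof. by []. Qed.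
Lemma l20_val k : (0 : l2 R) k = 0. Proof. by []. Qed.

Lemma l2norm0 : l2norm (0 : l2 R) = 0.
Proof.
apply/le_anti; rewrite l2norm_ge0 andbT; apply: l2norm_le_box => // N.
rewrite /box_sum !big1 ?addr0 ?expr0n// => n _;
  by rewrite l20_val normc0 expr0n.
Qed.

Lemma l2norm_scale (M : R) x y : 0 <= M ->
  (forall k, normc (y k) <= M * normc (x k)) -> l2norm y <= M * l2norm x.
Proof.
move=> M0 yx; apply: l2norm_le_box => [|N].
  by rewrite mulr_ge0 ?l2norm_ge0.
rewrite exprMn (le_trans _ (ler_wpM2l _ (box_le_l2norm x N))) ?sqr_ge0//.
rewrite -box_sumZ; apply: ler_box_sum => l.
by rewrite -exprMn ler_pXn2r ?nnegrE ?normc_ge0// mulr_ge0 ?normc_ge0.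
Qed.

Lemma normcD_le (a b : C) : normc (a + b) <= normc a + normc b.
Proof. exact: le_normcD. Qed.

(* Minkowski: |a + b|^2 <= (1 + t)|a|^2 + (1 + 1/t)|b|^2 summed with
   t = |y| / |x|. *)
Lemma l2normD x y : l2norm (x + y) <= l2norm x + l2norm y.
Proof.
have [/l2norm0_eq0 ->|x0] := eqVneq (l2norm x) 0.
  by rewrite add0r l2norm0 add0r.
have [/l2norm0_eq0 ->|y0] := eqVneq (l2norm y) 0.
  by rewrite addr0 l2norm0 addr0.
have xp : 0 < l2norm x by rewrite lt_def x0 l2norm_ge0.
have yp : 0 < l2norm y by rewrite lt_def y0 l2norm_ge0.
apply: l2norm_le_box => [|N]; first by rewrite addr_ge0 ?l2norm_ge0.
set X := l2norm x; set Y := l2norm y.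
apply: (@le_trans _ _ (box_sum (fun l =>
    (1 + Y / X) * normc (x l) ^+ 2 + (1 + X / Y) * normc (y l) ^+ 2) N)).
  apply: ler_box_sum => l; rewrite l2D_val.
  apply: (@le_trans _ _ ((normc (x l) + normc (y l)) ^+ 2)).
    by rewrite ler_pXn2r ?nnegrE ?addr_ge0 ?normc_ge0 ?normcD_le.
  set a := normc (x l); set b := normc (y l); rewrite -subr_ge0.
  rewrite (_ : _ - _ = (Y * a - X * b) ^+ 2 / (X * Y)); last by field; apply/andP.
  by rewrite divr_ge0 ?sqr_ge0// mulr_ge0// ltW.
rewrite box_sumD !box_sumZ.
rewrite (_ : (X + Y) ^+ 2 = (1 + Y / X) * X ^+ 2 + (1 + X / Y) * Y ^+ 2);
  last first.
  by field; apply/andP.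
have H t : 0 <= t -> 0 <= 1 + t by move=> t0; rewrite addr_ge0.
by rewrite lerD// ler_wpM2l ?box_le_l2norm// H// divr_ge0// ltW.
Qed.

Lemma l2normN x : l2norm (- x) = l2norm x.
Proof.
by apply/le_anti; rewrite !ler_l2norm// => k; rewrite l2N_val normcN.
Qed.

Lemma l2normB x y : l2norm (x - y) = l2norm (y - x).
Proof. by rewrite -l2normN opprB. Qed.

Lemma l2normZ (a : C) x : l2norm (a *: x) <= normc a * l2norm x.
Proof.
by apply: l2norm_scale => [|k]; rewrite ?normc_ge0// l2Z_val normcM.
Qed.

Lemma l2norm_sum (I : Type) (r : seq I) (u : I -> l2 R) :
  l2norm (\sum_(i <- r) u i) <= \sum_(i <- r) l2norm (u i).
Proof.
elim/big_ind2: _ => [|a b c d ab cd|//]; first by rewrite l2norm0.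
by rewrite (le_trans (l2normD _ _))// lerD.
Qed.

End l2norm.
(** * The inner product *)

Section complex_topology.
Variable R : realType.
Local Notation C := R[i].

(** The norm of [C^o] has values in [C], but a positive element of [C] has zero imaginary part, so
    complex and real tolerances amount to the same. *)
Lemma cvgCP (T : Type) (F : set_system T) (FF : Filter F) (f : T -> C) (z : C) :
  (f : T -> C^o) @ F --> (z : C^o) <->
  forall e : R, 0 < e -> \forall t \near F, normc (z - f t) < e.
Proof.
have nE (w : C) : `|w| = (normc w)%:C by case: w.
split=> [/cvgrPdist_lt H e e0|H].
  have /H : (0 : C) < e%:C by rewrite ltcR.
  by apply: filterS => t; rewrite nE ltcR.
apply/cvgrPdist_lt => -[e e']; rewrite ltcE /= => /andP[/eqP -> e0].
by move: (H _ e0); apply: filterS => t; rewrite nE ltcR.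
Qed.

Lemma continuousCP (T : topologicalType) (f : T -> C) (x : T) :
  {for x, continuous (f : T -> C^o)} <->
  forall e : R, 0 < e -> \forall t \near x, normc (f x - f t) < e.
Proof. exact: cvgCP. Qed.

Lemma normc_le_ReIm (z : C) : normc z <= `|complex.Re z| + `|complex.Im z|.
Proof.
case: z => a b /=; rewrite -(@ler_pXn2r _ 2) ?nnegrE ?sqrtr_ge0 ?addr_ge0//.
rewrite sqr_sqrtr ?addr_ge0 ?sqr_ge0// sqrrD !real_normK ?num_real//.
by rewrite addrAC lerDl mulrn_wge0// mulr_ge0.
Qed.

Lemma cvgC_ReIm (T : Type) (F : set_system T) (FF : Filter F) (f : T -> C)
    (a b : R) :
  (fun t => complex.Re (f t)) @ F --> a -> (fun t => complex.Im (f t)) @ F --> b ->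
  (f : T -> C^o) @ F --> (a +i* b : C^o).
Proof.
move=> /cvgrPdist_lt fa /cvgrPdist_lt fb; apply/cvgCP => e e0.
near=> t; apply: le_lt_trans (normc_le_ReIm _) _.
rewrite (_ : complex.Re _ = a - complex.Re (f t)); last by case: (f t).
rewrite (_ : complex.Im _ = b - complex.Im (f t)); last by case: (f t).
rewrite [e]splitr; apply: ltrD; near: t.
- by apply: fa; rewrite divr_gt0.
- by apply: fb; rewrite divr_gt0.
Unshelve. all: by end_near. Qed.

End complex_topology.

Section inner_product.
Variable R : realType.
Local Notation C := R[i].
Implicit Types (x y z : l2 R) (k : int).

(** A relational form of [sumZ] for real families. It carries the convergence of both half-series,
    without which [limn] is not additive; identities between sums then follow from pointwise ones by
    uniqueness. *)
Definition is_sumZ (g : int -> R) (v : R) : Prop :=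
  exists p q : R, [/\ series (fun n : nat => g n%:Z) @ \oo --> p,
    series (fun n : nat => g (- n.+1%:Z)) @ \oo --> q & v = p + q].

Lemma is_sumZ_unique g v w : is_sumZ g v -> is_sumZ g w -> v = w.
Proof.
move=> [p [q [gp gq ->]]] [p' [q' [gp' gq' ->]]]; congr (_ + _).
  exact: cvg_unique gp gp'.
exact: cvg_unique gq gq'.
Qed.

Lemma is_sumZD g h v w : is_sumZ g v -> is_sumZ h w ->
  is_sumZ (fun l => g l + h l) (v + w).
Proof.
move=> [p [q [gp gq ->]]] [p' [q' [gp' gq' ->]]].
exists (p + p'), (q + q'); split; last by rewrite addrACA.
- rewrite (_ : series _ = series (fun n : nat => g n%:Z) \+ series (fun n : nat => h n%:Z)).
    exact: cvgD.
  by apply/funext => N; rewrite /series /= big_split.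
- rewrite (_ : series _ = series (fun n : nat => g (- n.+1%:Z)) \+
      series (fun n : nat => h (- n.+1%:Z))).
    exact: cvgD.
  by apply/funext => N; rewrite /series /= big_split.
Qed.

Lemma is_sumZZ (a : R) g v : is_sumZ g v -> is_sumZ (fun l => a * g l) (a * v).
Proof.
move=> [p [q [gp gq ->]]]; exists (a * p), (a * q); split; last by rewrite mulrDr.
- rewrite (_ : series _ = fun N => a * series (fun n : nat => g n%:Z) N).
    exact: cvgMr.
  by apply/funext => N; rewrite /series /= mulr_sumr.
- rewrite (_ : series _ = fun N => a * series (fun n : nat => g (- n.+1%:Z)) N).
    exact: cvgMr.
  by apply/funext => N; rewrite /series /= mulr_sumr.
Qed.

Lemma is_sumZ_l2norm x : is_sumZ (fun l => normc (x l) ^+ 2) (l2norm x ^+ 2).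
Proof.
have H (u : nat -> R) : (forall n, 0 <= u n) ->
    (forall N, \sum_(0 <= n < N) u n <= l2norm x ^+ 2) -> cvgn (series u).
  move=> u0 uM; apply: nondecreasing_is_cvgn.
    by apply: nondecreasing_series => n _ _.
  by exists (l2norm x ^+ 2) => _ [n _ <-]; exact: uM.
have s0 (v : nat -> C) N : 0 <= \sum_(0 <= n < N) normc (v n) ^+ 2.
  by rewrite sumr_ge0// => *; exact: sqr_ge0.
have p : cvgn (series (fun n : nat => normc (x n%:Z) ^+ 2)).
  apply: H => [n|N]; first exact: sqr_ge0.
  by apply: le_trans (box_le_l2norm x N); rewrite lerDl s0.
have q : cvgn (series (fun n : nat => normc (x (- n.+1%:Z)) ^+ 2)).
  apply: H => [n|N]; first exact: sqr_ge0.
  by apply: le_trans (box_le_l2norm x N); rewrite lerDr s0.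
exists (limn (series (fun n : nat => normc (x n%:Z) ^+ 2))).
exists (limn (series (fun n : nat => normc (x (- n.+1%:Z)) ^+ 2))).
split => //; apply/esym; have /cvg_lim <- := @cvg_box_l2norm R x => //.
by apply/esym/cvg_lim => //; exact: cvgD.
Qed.

(* The real part of the inner product. Written by polarization, it is visibly
   invariant under isometries, although sumZ is not visibly invariant under
   permutations of the indices. *)
Definition rinner x y : R := (l2norm (x + y) ^+ 2 - l2norm (x - y) ^+ 2) / 4.

Lemma is_sumZ_rinner x y :
  is_sumZ (fun l => complex.Re (x l * (y l)^*)) (rinner x y).
Proof.
have := is_sumZZ 4^-1 (is_sumZD (is_sumZ_l2norm (x + y))
  (is_sumZZ (- 1) (is_sumZ_l2norm (x - y)))).
rewrite mulN1r mulrC; congr is_sumZ; apply/funext => l.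
rewrite l2D_val l2D_val l2N_val !normc_sqr.
by case: (x l) (y l) => a b [c d] /=; field.
Qed.

(** Since conj (i y) = - i conj y, the imaginary part of x conj y is the real part of x conj (i
    y). *)
Lemma innerE x y : inner x y = rinner x y +i* rinner x ('i *: y).
Proof.
have [p [q [Rp Rq ->]]] := is_sumZ_rinner x y.
have [p' [q' [Ip Iq ->]]] := is_sumZ_rinner x ('i *: y).
have ImE l : complex.Re (x l * (('i *: y) l)^*) = complex.Im (x l * (y l)^*).
  by rewrite l2Z_val; case: (x l) (y l) => a b [c d] /=; ring.
have sRe (u : nat -> C) N :
    complex.Re (series (u : nat -> C^o) N) = series (fun n => complex.Re (u n)) N.
  by rewrite /series /= raddf_sum.
have sIm (u : nat -> C) N :
    complex.Im (series (u : nat -> C^o) N) = series (fun n => complex.Im (u n)) N.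
  by rewrite /series /= raddf_sum.
have ImF (h : nat -> int) : (fun n => complex.Im (x (h n) * (y (h n))^*)) =
    (fun n => complex.Re (x (h n) * (('i *: y) (h n))^*)).
  by apply/funext => n; rewrite ImE.
rewrite /inner /sumZ.
rewrite (_ : limn _ = (p +i* p' : C^o)); last first.
  apply/cvg_lim => //; apply: cvgC_ReIm; first by under eq_fun do rewrite sRe.
  by under eq_fun do rewrite sIm; rewrite (ImF Posz).
rewrite (_ : limn _ = (q +i* q' : C^o))//.
apply/cvg_lim => //; apply: cvgC_ReIm; first by under eq_fun do rewrite sRe.
by under eq_fun do rewrite sIm; rewrite (ImF (fun n : nat => - n.+1%:Z)).
Qed.

Lemma is_sumZ_ge0 g v : (forall l, 0 <= g l) -> is_sumZ g v -> 0 <= v.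
Proof.
move=> g0 [p [q [gp gq ->]]]; apply: addr_ge0.
  by rewrite -(cvg_lim _ gp)//; apply: limr_ge;
    [exact: cvgP gp|apply: nearW => n; exact: sumr_ge0].
by rewrite -(cvg_lim _ gq)//; apply: limr_ge;
  [exact: cvgP gq|apply: nearW => n; exact: sumr_ge0].
Qed.

Lemma rinnerC x y : rinner x y = rinner y x.
Proof. by rewrite /rinner [y + x]addrC [l2norm (y - x)]l2normB. Qed.

Lemma rinnerDl x y z : rinner (x + y) z = rinner x z + rinner y z.
Proof.
apply: (is_sumZ_unique (is_sumZ_rinner _ _)).
have := is_sumZD (is_sumZ_rinner x z) (is_sumZ_rinner y z).
by congr is_sumZ; apply/funext => l; rewrite l2D_val mulrDl raddfD.
Qed.

Lemma rinnerNl x y : rinner (- x) y = - rinner x y.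
Proof. 
rewrite /rinner -opprD l2normN [- x + y]addrC [l2norm (y - x)]l2normB.
by field.
Qed.

Lemma rinnerxx x : rinner x x = l2norm x ^+ 2.
Proof.
apply: (is_sumZ_unique (is_sumZ_rinner _ _)).
have := is_sumZ_l2norm x; congr is_sumZ; apply/funext => l.
by rewrite normc_sqr; case: (x l) => a b /=; ring.
Qed.

(** Cauchy-Schwarz in weighted form, from |t x - y|^2 / t >= 0 in each coordinate. The free
    parameter [t] serves to absorb a term in [asymp_commutant_adjoint]. *)
Lemma rinner_le x y (t : R) : 0 < t ->
  rinner x y <= (t * l2norm x ^+ 2 + t^-1 * l2norm y ^+ 2) / 2.
Proof.
move=> t0; rewrite ler_pdivlMr// -subr_ge0.
have := is_sumZD (is_sumZD (is_sumZZ t (is_sumZ_l2norm x))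
  (is_sumZZ t^-1 (is_sumZ_l2norm y))) (is_sumZZ (- 2) (is_sumZ_rinner x y)).
rewrite mulNr [2 * _]mulrC; apply: is_sumZ_ge0 => l; rewrite !normc_sqr.
case: (x l) (y l) => a b [c d] /=.
rewrite [leRHS](_ : _ = ((t * a - c) ^+ 2 + (t * b - d) ^+ 2) / t).
  by rewrite divr_ge0 ?(ltW t0)// addr_ge0 ?sqr_ge0.
by field; rewrite gt_eqF.
Qed.

Lemma l2norm_ebasis k : l2norm (ebasis R k) = 1.
Proof.
apply/eqP; rewrite -sqrp_eq1 ?l2norm_ge0// -eqe -sqsumE /sqsum.
rewrite (_ : esum _ _ = \esum_(l in [set k]) (1 : \bar R))%E.
  by rewrite esum_set1.
rewrite [RHS]esum_mkcond; apply: eq_esum => l _; rewrite ebasisE.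
case: ifPn => [/set_mem ->|kl]; first by rewrite eqxx normc1 expr1n.
by rewrite (_ : (l == k) = false) ?normc0 ?expr0n//;
  apply: contraNF kl => /eqP ->; exact/mem_set.
Qed.

Lemma rinner_ebasisr x (a : C) k :
  rinner x (a *: ebasis R k) = complex.Re (x k * a^*).
Proof.
apply: (is_sumZ_unique (is_sumZ_rinner _ _)).
have := is_sumZZ (complex.Re (x k * a^*)) (is_sumZ_l2norm (ebasis R k)).
rewrite l2norm_ebasis expr1n mulr1; congr is_sumZ; apply/funext => l.
rewrite l2Z_val ebasisE; have [->|_] := eqVneq.
  by rewrite normc1 expr1n !mulr1.
by rewrite normc0 expr0n mulr0 mulr0 raddf0 mulr0.
Qed.

Lemma inner_ebasisr x k : inner x (ebasis R k) = x k.
Proof.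
rewrite innerE -[X in rinner x X +i* _]scale1r !rinner_ebasisr.
by case: (x k) => a b /=; congr (_ +i* _); ring.
Qed.

Lemma inner_ebasisl x k : inner (ebasis R k) x = (x k)^*.
Proof.
rewrite innerE ![rinner (ebasis R k) _]rinnerC.
rewrite -[X in rinner _ X +i* _]scale1r -[X in _ +i* rinner _ X]scale1r.
rewrite !rinner_ebasisr l2Z_val.
by case: (x k) => a b /=; congr (_ +i* _); ring.
Qed.

Lemma inner0r x : inner x 0 = 0.
Proof. by rewrite innerE scaler0 /rinner addr0 subr0 subrr mul0r. Qed.

Lemma is_adjoint_rinner (T S : l2 R -> l2 R) : is_adjoint T S ->
  forall x y, rinner (T x) y = rinner x (S y).
Proof. by move=> TS x y; have := TS x y; rewrite !innerE => -[]. Qed.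

End inner_product.
(** * Bounded operators and asymptotic commutants *)

Section operators.
Variable R : realType.
Local Notation C := R[i].
Local Notation H := (l2 R).
Implicit Types (T S P : H -> H) (x y : H).

Lemma lin0 T : linear T -> T 0 = 0.
Proof. by move=> /(_ (-1) 0 0); rewrite scaler0 addr0 scaleN1r addNr. Qed.

Lemma linD T x y : linear T -> T (x + y) = T x + T y.
Proof. by move=> /(_ 1 x y); rewrite !scale1r. Qed.

Lemma linZ T (a : C) x : linear T -> T (a *: x) = a *: T x.
Proof. by move=> Tl; have := Tl a x 0; rewrite (lin0 Tl) !addr0. Qed.

Lemma linB T x y : linear T -> T (x - y) = T x - T y.
Proof. by move=> Tl; rewrite linD// -scaleN1r linZ// scaleN1r. Qed.

Lemma bounded_ex T : bounded_op T ->
  exists2 M : R, 0 < M & forall x, l2norm (T x) <= M * l2norm x.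
Proof.
move=> [_ [M TM]]; exists (`|M| + 1) => [|x]; first exact: ltr_wpDl.
apply: le_trans (TM x) _; apply: ler_wpM2r; first exact: l2norm_ge0.
by rewrite ler_wpDr// ler_norm.
Qed.

(** Boundedness makes the set under [sup] bounded above; the vector is then rescaled to norm 1. *)
Lemma opnorm_ge T x : bounded_op T -> l2norm (T x) <= opnorm T * l2norm x.
Proof.
move=> Tb; have [Tl _] := Tb; have [M M0 TM] := bounded_ex Tb.
have [/l2norm0_eq0 ->|x0] := eqVneq (l2norm x) 0.
  by rewrite lin0// l2norm0 mulr0.
have xp : 0 < l2norm x by rewrite lt_def x0 l2norm_ge0.
pose a : C := (l2norm x)^-1%:C.
have na : normc a = (l2norm x)^-1.
  by rewrite /= expr0n addr0 sqrtr_sqr ger0_norm// invr_ge0 ltW.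
have xa : x = (l2norm x)%:C *: (a *: x).
  by rewrite scalerA -rmorphM /= mulfV// scale1r.
rewrite {1}xa linZ// (le_trans (l2normZ _ _))// mulrC.
rewrite /= expr0n addr0 sqrtr_sqr (ger0_norm (l2norm_ge0 x)).
apply: ler_wpM2r; first exact: l2norm_ge0.
apply: ub_le_sup.
  exists M => _ [y /= y1 <-]; apply: le_trans (TM y) _.
  by rewrite -[leRHS]mulr1 ler_wpM2l// ltW.
exists (a *: x) => //=; apply: le_trans (l2normZ _ _) _.
by rewrite na mulVf.
Qed.

Lemma opnorm_ge0 T : bounded_op T -> 0 <= opnorm T.
Proof.
move=> Tb; have := opnorm_ge (ebasis R 0) Tb.
by rewrite l2norm_ebasis mulr1; apply: le_trans; exact: l2norm_ge0.
Qed.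

Lemma opnorm_le T (M : R) : 0 <= M ->
  (forall x, l2norm (T x) <= M * l2norm x) -> opnorm T <= M.
Proof.
move=> M0 TM; apply: ge_sup; first by exists (l2norm (T 0)), 0; rewrite //= l2norm0.
move=> _ [x /= x1 <-]; apply: le_trans (TM x) _.
by rewrite -[leRHS]mulr1 ler_wpM2l.
Qed.

Lemma bounded_opD T S : bounded_op T -> bounded_op S -> bounded_op (T + S).
Proof.
move=> [Tl [M TM]] [Sl [N SN]]; split.
  by move=> a x y; rewrite !fctE Tl Sl scalerDr addrACA.
exists (M + N) => x; rewrite fctE mulrDl.
by apply: le_trans (l2normD _ _) _; rewrite lerD.
Qed.

Lemma bounded_opZ (k : C) T : bounded_op T -> bounded_op (k *: T).
Proof.
move=> [Tl [M TM]]; split.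
  by move=> a x y; rewrite !fctE Tl scalerDr !scalerA mulrC.
exists (normc k * M) => x; rewrite fctE -mulrA.
by apply: le_trans (l2normZ _ _) _; rewrite ler_wpM2l// normc_ge0.
Qed.

Lemma bounded_opB T S : bounded_op T -> bounded_op S -> bounded_op (T - S).
Proof.
by move=> Tb Sb; rewrite -scaleN1r; apply: bounded_opD => //; exact: bounded_opZ.
Qed.

Lemma bounded_op_comp T S : bounded_op T -> bounded_op S ->
  bounded_op (T \o S).
Proof.
move=> Tb [Sl [N SN]]; have [M M0 TM] := bounded_ex Tb; have [Tl _] := Tb.
split; first by move=> a x y /=; rewrite Sl Tl.
exists (M * N) => x /=; apply: le_trans (TM _) _.
by rewrite -mulrA ler_wpM2l// ltW.
Qed.

Lemma norm_cvg_near (T_ : nat -> H -> H) T :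
  (forall n, bounded_op (T_ n)) -> bounded_op T -> norm_cvg T_ T ->
  forall e : R, 0 < e ->
  \forall n \near \oo, forall x, l2norm (T_ n x - T x) <= e * l2norm x.
Proof.
move=> Tnb Tb /cvgrPdist_lt Tcv e /Tcv; apply: filterS => n.
have TTb : bounded_op (T_ n - T) by exact: bounded_opB.
rewrite sub0r normrN ger0_norm; last exact: opnorm_ge0.
move=> /ltW Hn x; apply: le_trans (opnorm_ge x TTb) _.
by rewrite ler_wpM2r// l2norm_ge0.
Qed.

Definition isometric_involution P : Prop :=
  [/\ linear P, forall x, l2norm (P x) = l2norm x & forall x, P (P x) = x].

(** Write y as P (P y): by polarization an isometry preserves [rinner]. *)
Lemma isometric_involution_adjoint P x y : isometric_involution P ->
  rinner (P x) y = rinner x (P y).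
Proof.
move=> [Pl Pi PK]; rewrite -{1}[y]PK /rinner.
by rewrite -!linD// -!linB// !Pi.
Qed.

Variable D : nat -> set (H -> H).
Hypothesis D_invol : forall J P, D J P -> isometric_involution P.

(** The bound is uniform over [D J]. For swaps of orbits that agree to J digits this encodes s-adic
    uniform continuity of all matrix entries; for a constant family it is the exact commutant. *)
Definition asymp_commutant : set (H -> H) := [set T | bounded_op T /\
  forall e : R, 0 < e -> \forall J \near \oo, forall P, D J P ->
    forall x, l2norm (T (P x) - P (T x)) <= e * l2norm x].

(** As P is self-adjoint, the commutator of P with the adjoint S is, up to sign, the adjoint of its
    commutator with T. Its value z at x is estimated by moving everything in |z|^2 = <z, z> onto
    x. *)
Lemma asymp_commutant_adjoint T S : asymp_commutant T -> bounded_op S ->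
  is_adjoint T S -> asymp_commutant S.
Proof.
move=> [Tb Tc] Sb TS; split => // e e0; have := Tc e e0.
apply: filterS => J HJ P DP x; have Pi := D_invol DP.
set z := S (P x) - P (S x).
have adj u v : rinner (S u) v = rinner u (T v).
  by rewrite rinnerC -(is_adjoint_rinner TS) rinnerC.
have zz : l2norm z ^+ 2 = rinner x (P (T z) - T (P z)).
  rewrite -rinnerxx {1}/z rinnerDl rinnerNl adj.
  rewrite !(isometric_involution_adjoint _ _ Pi) adj.
  by rewrite ![rinner x _]rinnerC rinnerDl rinnerNl.
(* With t = e^2 the commutator term is at most |z|^2, so |z|^2 <= (e^2 |x|^2 + |z|^2) / 2; absorbing
   half of |z|^2 leaves |z| <= e |x|. *)
have := @rinner_le R x (P (T z) - T (P z)) (e ^+ 2) (exprn_gt0 _ e0).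
rewrite -zz l2normB => zle.
rewrite -(@ler_pXn2r _ 2) ?nnegrE ?mulr_ge0 ?l2norm_ge0 ?(ltW e0)//.
have : l2norm (T (P z) - P (T z)) ^+ 2 <= (e * l2norm z) ^+ 2.
  by rewrite ler_pXn2r ?nnegrE ?mulr_ge0 ?l2norm_ge0 ?(ltW e0)//; exact: HJ.
rewrite !exprMn => h.
have : (e ^+ 2)^-1 * l2norm (T (P z) - P (T z)) ^+ 2 <= l2norm z ^+ 2.
  by rewrite ler_pdivrMl// exprn_gt0.
move: zle; lra.
Qed.

(** Leibniz rule: [T S, P] = T [S, P] + [T, P] S. *)
Lemma asymp_commutant_comp T S : asymp_commutant T -> asymp_commutant S ->
  asymp_commutant (T \o S).
Proof.
move=> [Tb Tc] [Sb Sc]; split=> [|e e0]; first exact: bounded_op_comp.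
have [M M0 TM] := bounded_ex Tb; have [N N0 SN] := bounded_ex Sb.
have [Tl _] := Tb.
have eN : 0 < e / 2 / N by rewrite !divr_gt0.
have eM : 0 < e / 2 / M by rewrite !divr_gt0.
near=> J => P DP x /=.
rewrite (_ : _ - _ = T (S (P x) - P (S x)) + (T (P (S x)) - P (T (S x))));
  last first.
  by rewrite (linB _ _ Tl) addrA subrK.
apply: le_trans (l2normD _ _) _; rewrite [e]splitr mulrDl; apply: lerD.
  apply: le_trans (TM _) _; rewrite -ler_pdivlMl// mulrA [M^-1 * _]mulrC.
  by move: P DP x; near: J; exact: Sc.
apply: (@le_trans _ _ (e / 2 / N * l2norm (S x))).
  by move: P DP (S x); near: J; exact: Tc.
by rewrite -mulrA ler_wpM2l ?divr_ge0 ?(ltW e0)// ler_pdivrMl.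
Unshelve. all: by end_near. Qed.

(** One approximant [T_ n] is fixed first, and only then J: since P is isometric, the error of
    approximation enters twice, independently of P and J. *)
Lemma asymp_commutant_closed (T_ : nat -> H -> H) T :
  (forall n, asymp_commutant (T_ n)) -> bounded_op T -> norm_cvg T_ T ->
  asymp_commutant T.
Proof.
move=> Tn Tb Tcv; split=> // e e0; have e3 : 0 < e / 3 by rewrite divr_gt0.
have Tnb n : bounded_op (T_ n) by have [] := Tn n.
have [n _ /(_ n (leqnn n)) Hn] := norm_cvg_near Tnb Tb Tcv e3.
have [_ /(_ _ e3)] := Tn n.
apply: filterS => J HJ P DP x; have [Pl Pi _] := D_invol DP.
rewrite (_ : _ - _ = (T (P x) - T_ n (P x)) + (T_ n (P x) - P (T_ n x))
   + P (T_ n x - T x)); last first.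
  by rewrite (linB _ _ Pl) !addrA !subrK.
rewrite (_ : e * _ = e / 3 * l2norm x + e / 3 * l2norm x + e / 3 * l2norm x);
  last by field.
apply: le_trans (l2normD _ _) _; apply: lerD; last by rewrite Pi.
apply: le_trans (l2normD _ _) _; apply: lerD; last exact: HJ.
by rewrite l2normB -[l2norm x]Pi.
Qed.

Lemma asymp_commutant_Cstar : Cstar_subalgebra asymp_commutant.
Proof.
split.
- by move=> T [].
- move=> T S [Tb Tc] [Sb Sc]; split=> [|e e0]; first exact: bounded_opD.
  have e2 : 0 < e / 2 by rewrite divr_gt0.
  near=> J => P DP x; have [Pl _ _] := D_invol DP.
  rewrite !fctE linD// opprD addrACA [e]splitr mulrDl.
  apply: le_trans (l2normD _ _) _; apply: lerD.
    by move: P DP {Pl} x; near: J; exact: Tc.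
  by move: P DP {Pl} x; near: J; exact: Sc.
- move=> k T [Tb Tc]; split=> [|e e0]; first exact: bounded_opZ.
  have k1 : 0 < normc k + 1 by rewrite ltr_wpDl// normc_ge0.
  have := Tc _ (divr_gt0 e0 k1); apply: filterS => J HJ P DP x.
  have [Pl _ _] := D_invol DP.
  rewrite !fctE linZ// -scalerBr; apply: le_trans (l2normZ _ _) _.
  apply: (@le_trans _ _ ((normc k + 1) * l2norm (T (P x) - P (T x)))).
    by rewrite ler_wpM2r ?l2norm_ge0// lerDl.
  rewrite -ler_pdivlMl// mulrA [_^-1 * _]mulrC; exact: HJ.
- exact: asymp_commutant_comp.
- exact: asymp_commutant_adjoint.
- exact: asymp_commutant_closed.
Unshelve. all: by end_near. Qed.

(** Induction principle for [HS]: it is the intersection of all C*-subalgebras containing the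
    generators, and the asymptotic commutant is such a subalgebra as soon as it contains them. *)
Lemma HS_asymp_commutant s : asymp_commutant (@V R s) ->
  (forall f : Zadic s -> C, continuous (f : Zadic s -> C^o) ->
    asymp_commutant (Mop f)) ->
  HS s `<=` asymp_commutant.
Proof.
move=> HV Hf T; apply; split; first exact: asymp_commutant_Cstar.
by move=> _ [->//|[f fc <-]]; exact: Hf.
Qed.

End operators.
(** * The s-adic integers *)

Section Zadic_topology.
Variable s : nat.
Local Notation Zs := (Zadic s).
Implicit Types x y : Zs.

(** Congruence modulo s^J, expressed by digits. *)
Definition agree (J : nat) x y : Prop := forall j, (j < J)%N -> x j = y j.

Lemma agree_sym J x y : agree J x y -> agree J y x.
Proof. by move=> xy j jJ; rewrite xy. Qed.

Lemma agree_trans J x y z : agree J x y -> agree J y z -> agree J x z.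
Proof. by move=> xy yz j jJ; rewrite xy// yz. Qed.

Lemma agree_le J K x y : (J <= K)%N -> agree K x y -> agree J x y.
Proof. by move=> JK xy j jJ; apply: xy; exact: leq_trans JK. Qed.

Lemma nbhs_digit x J : nbhs x [set y : Zs | x J = y J].
Proof.
pose a : discrete_topology 'Z_s := x J.
have xa : nbhs a [set a] by exact: discrete_set1.
have xaJ : nbhs x (proj J @^-1` [set a] : set Zs).
  exact: (@proj_continuous nat (fun=> discrete_topology 'Z_s) J x _ xa).
have sub : (proj J @^-1` [set a] : set Zs) `<=` [set y : Zs | x J = y J].
  by move=> y h; exact: (esym h).
exact: (@filterS _ (nbhs x) _ _ _ sub xaJ).
Qed.

Lemma nbhs_agree x J : nbhs x (agree J x).
Proof.
elim: J => [|J IH]; first exact: (@filterS _ (nbhs x) _ setT _ _ filterT).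
have sub y : agree J x y -> x J = y J -> agree J.+1 x y.
  by move=> xy xyJ j; rewrite ltnS leq_eqVlt => /predU1P[->//|]; exact: xy.
exact: (@filterS2 _ (nbhs x) _ _ _ _ sub IH (nbhs_digit x J)).
Qed.

(** If no J worked, one could choose for each J a point outside A sharing J digits with x; these
    points converge to x digit by digit, hence enter A. *)
Lemma agree_nbhs x (A : set Zs) : nbhs x A ->
  exists J, forall y, agree J x y -> A y.
Proof.
move=> xA; apply: contrapT => /forallNP nA.
have /choice[y_ yP] J : exists y, agree J x y /\ ~ A y.
  by have /existsNP[y /not_implyP[]] := nA J; exists y.
have : y_ @ \oo --> x.
  apply/(@pointwise_cvgP nat (discrete_topology 'Z_s)) => t.
  apply: cvg_near_cst; exists t.+1 => // J /= tJ.
  by apply/esym; have [+ _] := yP J; apply.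
by move=> /(_ _ xA)[J _ /(_ J (leqnn J))]; have [] := yP J.
Qed.

(** Tychonoff for a product of finite sets in which only the zeroth factor is restricted. *)
Lemma compact_Zadic_units : compact (@Zadic_units s).
Proof.
rewrite (_ : @Zadic_units s = [set x : Zs | forall j, (if j == 0%N then [set a | a != 0] else setT) (x j)]).
  apply: (@tychonoff nat (fun=> discrete_topology 'Z_s)
    (fun j => if j == 0%N then [set a | a != 0] else setT)) => j.
  by apply: finite_compact; apply: (@finite_finset 'Z_s).
apply/seteqP; split=> x /=; last by move=> /(_ 0%N).
by move=> x0 j; case: eqP => // ->.
Qed.

Lemma compact_Zadic : compact [set: Zs].
Proof.
rewrite (_ : setT = [set x : Zs | forall j, [set: 'Z_s] (x j)]).
  apply: (@tychonoff nat (fun=> discrete_topology 'Z_s) (fun=> setT)) => j.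
  by apply: finite_compact; apply: (@finite_finset 'Z_s).
by apply/seteqP; split.
Qed.

(** Heine-Cantor: the near-covering form of compactness, with the filter [\oo] on J, turns the local
    choices of J into a common one. *)
Lemma continuous_Zadic_unif (R : realType) (f : Zs -> R[i]) :
  continuous (f : Zs -> R[i]^o) -> forall e : R, 0 < e ->
  \forall J \near \oo, forall x y, agree J x y -> normc (f x - f y) <= e.
Proof.
move=> fc e e0; have e2 : 0 < e / 2 by rewrite divr_gt0.
have /compact_near_coveringP cov := compact_Zadic.
have := cov _ \oo (fun J x => forall y, agree J x y -> normc (f x - f y) <= e) _.
move=> H; suff : \forall J \near \oo, [set: Zs] `<=`
    [set x | forall y, agree J x y -> normc (f x - f y) <= e].
  by apply: filterS => J HJ x y; exact: HJ.
apply: H => x _; have /continuousCP/(_ _ e2)/agree_nbhs[J HJ] := fc x.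
exists (agree J x, [set K | (J <= K)%N]); first by split;
  [exact: nbhs_agree|exists J].
move=> [z K] /= [xz JK] y zy; rewrite [e]splitr.
rewrite (_ : _ - _ = (f x - f y) - (f x - f z)); last by ring.
apply: le_trans (normcD_le _ _) _; rewrite normcN; apply/ltW/ltrD; apply: HJ => //.
exact: agree_trans xz (agree_le JK zy).
Qed.

End Zadic_topology.

(** * Integers among the s-adic integers and the factorization k = s^m l *)

Section digits.
Variables (s : nat) (s_ge2 : (2 <= s)%N).
Local Notation Zs := (Zadic s).

Let s_gt0 : (0 < s)%N := ltnW s_ge2.

Lemma Zp_card_eq : ((Zp_trunc s).+2 = s)%N. Proof. exact: Zp_cast. Qed.

Lemma intr_Zp_eq0 (z : int) : (z%:~R == 0 :> 'Z_s) = (s%:Z %| z)%Z.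
Proof.
have H (n : nat) : (n%:R == 0 :> 'Z_s) = (s %| n)%N.
  by rewrite -val_eqE /= val_Zp_nat// /dvdn.
by case: z => n; rewrite ?NegzE ?rmorphN ?oppr_eq0 /= -pmulrn H dvdzE.
Qed.

Lemma int_Zadic0 (l : int) : int_Zadic s l 0 = l%:~R.
Proof. by rewrite /int_Zadic expn0 divz1. Qed.

Lemma Zadic_units_int (l : int) : Zadic_units (int_Zadic s l) <-> ~~ (s%:Z %| l)%Z.
Proof. by rewrite /Zadic_units /= int_Zadic0 intr_Zp_eq0. Qed.

Lemma int_ZadicM (l : int) : int_Zadic s (s%:Z * l) 0 = 0.
Proof. by rewrite int_Zadic0; apply/eqP; rewrite intr_Zp_eq0 dvdz_mulr. Qed.

Lemma int_ZadicMS (l : int) j : int_Zadic s (s%:Z * l) j.+1 = int_Zadic s l j.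
Proof. by rewrite /int_Zadic expnS PoszM divzMpl// ltz_nat. Qed.

Lemma agree_mul (J m : nat) (l l' : int) : agree J (int_Zadic s l) (int_Zadic s l') ->
  agree J (int_Zadic s ((s ^ m)%N%:Z * l)) (int_Zadic s ((s ^ m)%N%:Z * l')).
Proof.
move=> ll'; elim: m => [|m IH]; first by rewrite !mul1r.
rewrite expnS PoszM -!mulrA => -[|j] jJ; first by rewrite !int_ZadicM.
by rewrite !int_ZadicMS IH// ltnW.
Qed.

(** Horner form of x_0 + x_1 s + ... + x_(N-1) s^(N-1). These integers are the approximants through
    which functions on integers extend to s-adic units. *)
Fixpoint truncate (N : nat) (x : nat -> 'Z_s) : nat :=
  if N is N'.+1 then (x 0%N + s * truncate N' (fun j => x j.+1))%N else 0%N.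

Lemma agree_truncate (N : nat) (x : Zs) : agree N (int_Zadic s (truncate N x)) x.
Proof.
elim: N x => [//|N IH] x [|j] jN /=.
  by rewrite int_Zadic0 /= -pmulrn natrD natrM natr_Zp pchar_Zp// mul0r addr0.
rewrite -(IH (fun j => x j.+1) j jN) /int_Zadic !divz_nat; congr (Posz _)%:~R.
have xs : (x 0%N < s)%N by rewrite -{2}Zp_card_eq ltn_ord.
by rewrite expnS divnMA addnC [(s * truncate _ _)%N]mulnC (divnMDl _ _ s_gt0) (divn_small xs) addn0.
Qed.

Lemma truncate_unit (N : nat) (x : Zs) : (0 < N)%N -> Zadic_units x ->
  ~~ (s%:Z %| (truncate N x)%:Z)%Z.
Proof. by move=> N0 xu; apply/Zadic_units_int;
  rewrite /Zadic_units /= agree_truncate. Qed.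

Lemma int_decomp (k : int) : k != 0 ->
  exists m l, ~~ (s%:Z %| l)%Z /\ k = (s ^ m)%N%:Z * l.
Proof.
have [n] := ubnP `|k|%N; elim: n k => // n IH k kn k0.
have [/dvdzP[q kE]|sk] := boolP (s%:Z %| k)%Z; last first.
  by exists 0%N, k; rewrite mul1r.
have q0 : q != 0 by apply: contraNneq k0 => q0; rewrite kE q0 mul0r.
have [|m [l [sl qE]]] := IH q _ q0.
  rewrite -ltnS; apply: leq_trans kn; rewrite ltnS kE abszM absz_nat.
  by rewrite ltn_Pmulr// absz_gt0.
by exists m.+1, l; rewrite kE qE expnSr PoszM mulrAC.
Qed.

Lemma prime_part_pow (m : nat) (l : int) : ~~ (s%:Z %| l)%Z ->
  prime_part s ((s ^ m)%N%:Z * l) = l.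
Proof. by move=> sl; rewrite /prime_part vals_pow// mulKz// -lt0n expn_gt0 s_gt0. Qed.

(** The value at 0 is divisible by s and so differs from every orbit label l: E_0 belongs to no
    orbit {s^m l}. *)
Lemma prime_part0 : prime_part s 0 = 0.
Proof. by rewrite /prime_part div0z. Qed.

Lemma prime_part_mul (k : int) : prime_part s (s%:Z * k) = prime_part s k.
Proof.
have [->|/int_decomp[m [l [sl ->]]]] := eqVneq k 0; first by rewrite mulr0.
by rewrite mulrA -PoszM -expnS !prime_part_pow.
Qed.

End digits.
(** * Commutators of elements of HS with orbit swaps and sign changes *)

Section diagonal_and_permutation_operators.
Variable R : realType.
Local Notation C := R[i].
Implicit Types x y : l2 R.

Lemma compact_normc_bounded (T : topologicalType) (K : set T) (F : T -> C) :
  compact K -> {within K, continuous (F : T -> C^o)} ->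
  exists2 M : R, 0 <= M & forall t, K t -> normc (F t) <= M.
Proof.
move=> /compact_near_coveringP/near_covering_withinP cov /subspace_continuousP Fc.
have [t Kt|n _ nK] := cov _ \oo (fun (n : nat) t => normc (F t) <= n%:R).
  have /cvgCP/(_ 1 ltr01) Ft := Fc t Kt.
  have /= := Ft; rewrite near_withinE => Ft'.
  near=> u n => /= Ku; rewrite (_ : F u = F t - (F t - F u)); last by ring.
  apply: le_trans (normcD_le _ _) _; rewrite normcN.
  apply: (@le_trans _ _ (normc (F t) + 1)).
    by rewrite lerD2l ltW//; move: Ku; near: u.
  near: n; exact: nbhs_infty_ger.
by exists n%:R => // t Kt; apply: (nK n (leqnn n)).
Unshelve. all: by end_near. Qed.

Lemma diag_ss (a : int -> C) (M : R) x : 0 <= M -> (forall k, normc (a k) <= M) ->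
  (fun k => a k * x k) \in @square_summable R.
Proof.
move=> M0 aM; apply: (@ss_le _ _ (M ^+ 2 * l2norm x ^+ 2)) => N.
apply: le_trans (ler_wpM2l _ (box_le_l2norm x N)); last exact: sqr_ge0.
rewrite -box_sumZ; apply: ler_box_sum => l; rewrite normcM exprMn.
by rewrite ler_wpM2r ?sqr_ge0// ler_pXn2r ?nnegrE ?normc_ge0.
Qed.

(** The uniform bound guarantees that [mkl2] does not fall back to its default value 0. *)
Lemma diag_val (a : int -> C) (M : R) x k : (forall k, normc (a k) <= M) ->
  diag_op a x k = a k * x k.
Proof.
move=> aM; rewrite /diag_op mkl2K//; apply: (diag_ss x _ aM).
exact: le_trans (normc_ge0 _) (aM 0).
Qed.

Lemma diag_linear (a : int -> C) (M : R) : (forall k, normc (a k) <= M) ->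
  linear (diag_op a).
Proof.
move=> aM c x y; apply: l2P => k.
by rewrite (diag_val _ _ aM) !l2D_val !l2Z_val !(diag_val _ _ aM); ring.
Qed.

Lemma diag_norm (a : int -> C) (M : R) x : (forall k, normc (a k) <= M) ->
  l2norm (diag_op a x) <= M * l2norm x.
Proof.
move=> aM; apply: l2norm_scale => [|k].
  exact: le_trans (normc_ge0 (a 0)) (aM 0).
by rewrite (diag_val _ _ aM) normcM ler_wpM2r ?normc_ge0.
Qed.

Lemma diag_bounded (a : int -> C) (M : R) : (forall k, normc (a k) <= M) ->
  bounded_op (diag_op a).
Proof.
move=> aM; split; first exact: diag_linear aM.
by exists M => x; exact: diag_norm.
Qed.

Lemma diag_sign_involution (b : int -> bool) :
  isometric_involution (@diag_op R (fun k => (-1) ^+ b k)).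
Proof.
have b1 k : normc ((-1) ^+ b k : C) <= 1.
  by case: (b k); rewrite ?expr1 ?normcN normc1.
split; first exact: diag_linear b1.
  move=> x; apply/le_anti/andP; split; apply: ler_l2norm => k;
  by rewrite (diag_val _ _ b1) normcM; case: (b k);
    rewrite ?expr1 ?normcN ?normc1 mul1r.
move=> x; apply: l2P => k; rewrite !(diag_val _ _ b1) mulrA -expr2.
by rewrite sqrr_sign mul1r.
Qed.

Variable e : int -> int.
Hypothesis eK : involutive e.

Definition perm_op x : l2 R := mkl2 (fun k => x (e k)).

Lemma sqsum_perm x : sqsum (fun k => x (e k)) = sqsum x.
Proof.
apply: (@sqsum_pull _ e).
- by move=> i j _ _; exact: (inv_inj eK).
- by move=> l; rewrite eK.
- by move=> k nk; case: nk; exists (e k); rewrite eK.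
Qed.

Lemma perm_val x k : perm_op x k = x (e k).
Proof.
rewrite mkl2K// -topredE /= /square_summable sqsum_perm.
by have := l2_ss x; rewrite -topredE.
Qed.

Lemma perm_op_involution : isometric_involution perm_op.
Proof.
split.
- by move=> c x y; apply: l2P => k; rewrite perm_val !l2D_val !l2Z_val !perm_val.
- move=> x; rewrite /l2norm -(sqsum_perm x); congr (Num.sqrt (fine (sqsum _))).
  by apply/funext => k; rewrite perm_val.
- by move=> x; apply: l2P => k; rewrite !perm_val eK.
Qed.

End diagonal_and_permutation_operators.

(** * Commutation of the generators with orbit swaps and sign changes *)

Section Hensel_Steinitz.
Variables (R : realType) (s : nat) (s_ge2 : (2 <= s)%N).
Local Notation C := R[i].
Local Notation Zs := (Zadic s).
Implicit Types (x y : l2 R) (k l : int).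

Let s_gt0 : (0 < s)%N := ltnW s_ge2.

Lemma V_norm x : l2norm (V s x) = l2norm x.
Proof.
rewrite /l2norm (_ : sqsum (V s x) = sqsum x)//.
apply: (@sqsum_pull _ (fun l => s%:Z * l)).
- by move=> i j _ _ /mulfI; apply; rewrite -lt0n.
- by move=> l; rewrite V_val// dvdz_mulr// mulKz// -lt0n.
- move=> k nk; rewrite V_val//; case: ifP => // /dvdzP[q kq]; case: nk; exists q.
  by rewrite mulrC.
Qed.

Lemma V_linear : linear (@V R s).
Proof.
move=> c x y; apply: l2P => k; rewrite V_val// !l2D_val !l2Z_val !V_val//.
by case: ifP => // _; rewrite mulr0 addr0.
Qed.

Lemma V_bounded : bounded_op (@V R s).
Proof. by split; [exact: V_linear | exists 1 => x; rewrite V_norm mul1r]. Qed.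

Lemma Mop_normc_bounded (f : Zs -> C) : continuous (f : Zs -> C^o) ->
  exists2 M : R, 0 <= M & forall t, normc (f t) <= M.
Proof.
move=> fc; have [] := @compact_normc_bounded R Zs setT f (@compact_Zadic s).
  exact: continuous_subspaceT.
by move=> M M0 fM; exists M => // t; exact: fM.
Qed.

Definition swap (l l' : int) (k : int) : int :=
  if prime_part s k == l then (s ^ vals s k)%N%:Z * l'
  else if prime_part s k == l' then (s ^ vals s k)%N%:Z * l else k.

Section swap.
Variables (l l' : int).
Hypotheses (sl : ~~ (s%:Z %| l)%Z) (sl' : ~~ (s%:Z %| l')%Z).

Lemma swap_l m : swap l l' ((s ^ m)%N%:Z * l) = (s ^ m)%N%:Z * l'.
Proof. by rewrite /swap prime_part_pow// eqxx vals_pow. Qed.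

Lemma swap_r m : swap l l' ((s ^ m)%N%:Z * l') = (s ^ m)%N%:Z * l.
Proof. by rewrite /swap prime_part_pow// vals_pow// eqxx; case: eqP => [->|]. Qed.

(** The last case speaks of s k as well, since an orbit that is left alone is stable under
    multiplication by s; this is what [swap_mul] needs. *)
Lemma swap_cases k : [\/ exists m, k = (s ^ m)%N%:Z * l,
  exists m, k = (s ^ m)%N%:Z * l' | swap l l' k = k /\ swap l l' (s%:Z * k) = s%:Z * k].
Proof.
have [-> |/(int_decomp s_ge2)[m [j [sj kE]]]] := eqVneq k 0.
  have n0 j : ~~ (s%:Z %| j)%Z -> (0 == j :> int) = false.
    by move=> sj; apply: contraNF sj => /eqP <-; rewrite dvdz0.
  by apply: Or33; rewrite mulr0 /swap prime_part0 !n0.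
have [jl|jl] := eqVneq j l; first by apply: Or31; exists m; rewrite kE jl.
have [jl'|jl'] := eqVneq j l'; first by apply: Or32; exists m; rewrite kE jl'.
apply: Or33; rewrite /swap prime_part_mul// kE prime_part_pow//.
by rewrite (negbTE jl) (negbTE jl').
Qed.

Lemma swap_mul k : swap l l' (s%:Z * k) = s%:Z * swap l l' k.
Proof.
have [[m ->]|[m ->]|[-> ->]//] := swap_cases k;
by rewrite mulrA -PoszM -expnS ?swap_l ?swap_r expnS PoszM mulrA.
Qed.

Lemma swapK : involutive (swap l l').
Proof.
move=> k; have [[m ->]|[m ->]|[kE _]] := swap_cases k; last by rewrite !kE.
  by rewrite swap_l swap_r.
by rewrite swap_r swap_l.
Qed.

Lemma agree_swap J k : agree J (int_Zadic s l) (int_Zadic s l') ->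
  agree J (int_Zadic s k) (int_Zadic s (swap l l' k)).
Proof.
move=> ll'; have [[m ->]|[m ->]|[-> _]//] := swap_cases k.
  by rewrite swap_l; exact: agree_mul.
by rewrite swap_r; apply: agree_mul => //; exact: agree_sym.
Qed.

(** V changes only the exponent m and the swap only the factor l, so they commute exactly. *)
Lemma swap_op_V x : V s (perm_op (swap l l') x) = perm_op (swap l l') (V s x).
Proof.
apply: l2P => k; rewrite [LHS](V_val s_gt0) [RHS](perm_val swapK).
rewrite [RHS](V_val s_gt0).
have [/dvdzP[q ->]|sk] := boolP (s%:Z %| k)%Z.
  have s0 : s%:Z != 0 by rewrite -lt0n.
  by rewrite mulzK// [LHS](perm_val swapK) mulrC swap_mul dvdz_mulr// mulKz.
(* If s divided swap k, then, applying the swap once more, it would divide k. *)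
case: ifP => // /dvdzP[q sq]; case/negP: sk.
by rewrite -[k]swapK sq mulrC swap_mul dvdz_mulr.
Qed.

End swap.

Definition swap_ops (J : nat) : set (l2 R -> l2 R) :=
  [set P | exists l l', [/\ ~~ (s%:Z %| l)%Z, ~~ (s%:Z %| l')%Z,
    agree J (int_Zadic s l) (int_Zadic s l') & P = perm_op (swap l l')]].

Lemma swap_ops_involution J P : swap_ops J P -> isometric_involution P.
Proof. by move=> [l [l' [sl sl' _ ->]]]; apply: perm_op_involution;
  exact: swapK. Qed.

Lemma HS_swap (T : l2 R -> l2 R) : HS s T -> asymp_commutant swap_ops T.
Proof.
apply: (HS_asymp_commutant swap_ops_involution).
  split; first exact: V_bounded.
  move=> e e0; near=> J => P [l [l' [sl sl' _ ->]]] x.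
  by rewrite swap_op_V// subrr l2norm0 mulr_ge0 ?l2norm_ge0// ltW.
move=> f fc; have [M M0 fM] := Mop_normc_bounded fc.
have fM' k : normc (f (int_Zadic s k)) <= M by exact: fM.
split; first exact: diag_bounded fM'.
move=> e e0; have := continuous_Zadic_unif fc e0.
apply: filterS => J HJ P [l [l' [sl sl' ll' ->]]] x.
have [_ Pn _] := perm_op_involution R (swapK sl sl').
(* Measured against P x, which has the norm of x, the commutator is diagonal with coefficients f(k)
   - f(swap k), small because k and swap k share J digits. *)
rewrite -(Pn x); apply: l2norm_scale => [|k]; first exact: ltW.
have eM y j : Mop f y j = f (int_Zadic s j) * y j by exact: diag_val fM'.
have eP y j : perm_op (swap l l') y j = y (swap l l' j).
  exact: (perm_val (swapK sl sl')).
have : normc (f (int_Zadic s k) - f (int_Zadic s (swap l l' k))) <= e.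
  by apply: HJ; exact: agree_swap.
move: (Mop f) (perm_op (swap l l')) eM eP => S W eM eP ek.
by rewrite l2D_val l2N_val eM !eP eM -mulrBl normcM ler_wpM2r ?normc_ge0.
Unshelve. all: by end_near. Qed.

Definition block_sign (l k : int) : bool := prime_part s k == l.

(** The constant family {Q} is used. V commutes with Q because k and s k lie in the same orbit, M_f
    because both are diagonal; the commutator, being at most every e > 0, vanishes. *)
Lemma HS_block (T : l2 R -> l2 R) l x : HS s T ->
  T (diag_op (fun k => (-1) ^+ block_sign l k) x) =
  diag_op (fun k => (-1) ^+ block_sign l k) (T x).
Proof.
set Q := diag_op _.
have b1 k : normc ((-1) ^+ block_sign l k : C) <= 1.
  by case: (block_sign l k); rewrite ?expr1 ?normcN normc1.
have Qi : isometric_involution Q by exact: diag_sign_involution.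
move=> /(@HS_asymp_commutant _ (fun=> [set Q]) (fun _ _ => _)) H.
have [] := H.
- by move=> _ _ ->.
- split; first exact: V_bounded.
  move=> e e0; near=> J => P -> y.
  rewrite (_ : _ - _ = 0) ?l2norm0 ?mulr_ge0 ?l2norm_ge0 ?(ltW e0)//.
  apply/eqP; rewrite subr_eq0; apply/eqP/l2P => k.
  rewrite [LHS](V_val s_gt0) [RHS](diag_val _ _ b1) (V_val s_gt0).
  case: ifP => [/dvdzP[q ->]|]; last by rewrite mulr0.
  rewrite mulzK -?lt0n// (diag_val _ _ b1) /block_sign.
  by rewrite [q * _]mulrC prime_part_mul.
- move=> f fc; have [M M0 fM] := Mop_normc_bounded fc.
  have fM' k : normc (f (int_Zadic s k)) <= M by exact: fM.
  split; first exact: diag_bounded fM'.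
  move=> e e0; near=> J => P -> y.
  rewrite (_ : _ - _ = 0) ?l2norm0 ?mulr_ge0 ?l2norm_ge0 ?(ltW e0)//.
  apply/eqP; rewrite subr_eq0; apply/eqP/l2P => k.
  rewrite [LHS](diag_val _ _ fM') [RHS](diag_val _ _ b1) (diag_val _ _ b1).
  by rewrite (diag_val _ _ fM') mulrCA.
move=> _ Tc; apply/eqP; rewrite -subr_eq0; apply/eqP/l2norm0_eq0/le_anti.
rewrite l2norm_ge0 andbT; apply/ler_addgt0Pl => e e0; rewrite addr0.
(* The added 1 avoids dividing by zero when x = 0. *)
have x1 : 0 < l2norm x + 1 by rewrite ltr_wpDl// l2norm_ge0.
have [J _ /(_ J (leqnn J) Q erefl x)] := Tc _ (divr_gt0 e0 x1).
move=> /le_trans; apply; rewrite mulrAC ler_pdivrMr// ler_wpM2l ?(ltW e0)//.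
by rewrite lerDl.
Unshelve. all: by end_near. Qed.

End Hensel_Steinitz.
(** * Decay of the columns of elements of Iinf *)

Section weighted_shifts.
Variables (R : realType) (s : nat) (s_ge2 : (2 <= s)%N).
Local Notation C := R[i].
Local Notation Zs := (Zadic s).
Implicit Types (x y : l2 R) (k l : int) (F : nat * Zs -> C).

Let s_gt0 : (0 < s)%N := ltnW s_ge2.

Lemma Vstar_val x k : Vstar s x k = x (s%:Z * k).
Proof. by rewrite /Vstar mkl2K// Vstar_ss. Qed.

Lemma Vstar_linear : linear (@Vstar R s).
Proof.
have VE := Vstar_val; move: (@Vstar R s) VE => W WE c x y; apply: l2P => k.
by rewrite WE !l2D_val !l2Z_val !WE.
Qed.

(** V is isometric, and V (Vstar x) is x with the coordinates not divisible by s erased. *)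
Lemma Vstar_norm x : l2norm (Vstar s x) <= l2norm x.
Proof.
rewrite -(V_norm s_ge2); apply: ler_l2norm => k; rewrite (V_val s_gt0).
case: ifP => [/dvdzP[q ->]|_]; last by rewrite normc0 normc_ge0.
by rewrite mulzK -?lt0n// Vstar_val mulrC.
Qed.

Lemma iterV_bounded j : bounded_op (iter j (@V R s)).
Proof.
elim: j => [|j IH]; first by split=> [c x y //|]; exists 1 => x; rewrite mul1r.
exact: bounded_op_comp (V_bounded R s_ge2) IH.
Qed.

Lemma iterV_norm j x : l2norm (iter j (@V R s) x) = l2norm x.
Proof. by elim: j => // j IH; rewrite iterS V_norm. Qed.

Lemma iterVstar_bounded j : bounded_op (iter j (@Vstar R s)).
Proof.
elim: j => [|j IH]; first by split=> [c x y //|]; exists 1 => x; rewrite mul1r.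
apply: bounded_op_comp IH; split; first exact: Vstar_linear.
by exists 1 => x; rewrite mul1r Vstar_norm.
Qed.

Lemma iterVstar_norm j x : l2norm (iter j (@Vstar R s) x) <= l2norm x.
Proof. by elim: j => // j IH; rewrite iterS (le_trans (Vstar_norm _)). Qed.

Lemma iterV_val j x k : iter j (@V R s) x k =
  if ((s ^ j)%N%:Z %| k)%Z then x (k %/ (s ^ j)%N)%Z else 0.
Proof.
elim: j k => [|j IH] k; first by rewrite /= dvd1z divz1.
rewrite iterS (V_val s_gt0) expnS PoszM.
have [/dvdzP[q ->]|sk] := boolP (s%:Z %| k)%Z; last first.
  by rewrite ifF//; apply: contraNF sk; apply: dvdz_trans; exact: dvdz_mulr.
have s0 : s%:Z != 0 by rewrite -lt0n.
by rewrite mulzK// IH [q * _]mulrC dvdz_mul2l// divzMpl.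
Qed.

Lemma iterVstar_val j x k : iter j (@Vstar R s) x k = x ((s ^ j)%N%:Z * k).
Proof.
elim: j k => [|j IH] k; first by rewrite mul1r.
by rewrite iterS Vstar_val IH expnSr PoszM mulrA.
Qed.

Definition MF_coef F (k : int) : C :=
  if k == 0 then 0 else F (vals s k, int_Zadic s (prime_part s k)).

Lemma MF_coef_le F (B : R) : 0 <= B ->
  (forall m t, Zadic_units t -> normc (F (m, t)) <= B) ->
  forall k, normc (MF_coef F k) <= B.
Proof.
move=> B0 FB k; rewrite /MF_coef; have [_|k0] := eqVneq k 0;
  first by rewrite normc0.
have [m [l [sl ->]]] := int_decomp s_ge2 k0.
by apply: FB; rewrite prime_part_pow//; apply/Zadic_units_int.
Qed.

Lemma MFop_val F (B : R) x k : 0 <= B ->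
  (forall m t, Zadic_units t -> normc (F (m, t)) <= B) ->
  MFop F x k = MF_coef F k * x k.
Proof. by move=> B0 FB; apply: diag_val; exact: MF_coef_le FB. Qed.

Lemma MFop_norm F (B : R) x : 0 <= B ->
  (forall m t, Zadic_units t -> normc (F (m, t)) <= B) ->
  l2norm (MFop F x) <= B * l2norm x.
Proof. by move=> B0 FB; apply: diag_norm; exact: MF_coef_le FB. Qed.

Lemma MFop_bounded F (B : R) : 0 <= B ->
  (forall m t, Zadic_units t -> normc (F (m, t)) <= B) ->
  bounded_op (@MFop R s F).
Proof. by move=> B0 FB; apply: diag_bounded; exact: MF_coef_le FB. Qed.

(** Off the compact set for e = 1 the function is below 1, and on it continuity gives a bound. *)
Lemma C0_bounded F : C0 F -> exists2 B : R, 0 <= B &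
  forall m t, Zadic_units t -> normc (F (m, t)) <= B.
Proof.
move=> [Fc /(_ 1 ltr01)[K [cK KX FK]]].
have [|B B0 FB] := @compact_normc_bounded R _ K F cK.
  exact: continuous_subspaceW KX Fc.
exists (B + 1) => [|m t tu]; first by rewrite addr_ge0.
have [Kmt|nK] := pselect (K (m, t)).
  by apply: le_trans (FB _ Kmt) _; rewrite lerDl.
by apply: le_trans (ltW (FK _ _ nK)) _; rewrite ?lerDr.
Qed.

Lemma partial_sumE (F : int -> nat * Zs -> C) N x :
  partial_sum F N x = \sum_(j < N) iter j (@V R s) (MFop (F j%:Z) x) +
    \sum_(j < N) MFop (F (- j.+1%:Z)) (iter j.+1 (@Vstar R s) x).
Proof. by rewrite /partial_sum fctE !fct_sumE. Qed.

Lemma partial_sum_bounded (F : int -> nat * Zs -> C) N :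
  (forall n, exists2 B : R, 0 <= B &
     forall m t, Zadic_units t -> normc (F n (m, t)) <= B) ->
  bounded_op (partial_sum F N).
Proof.
move=> FB; apply: bounded_opD.
  elim/big_ind: _ => [|T S|j _]; [|exact: bounded_opD|].
    by split=> [c x y|]; [rewrite scaler0 addr0|exists 0 => x;
      rewrite l2norm0 mul0r].
  have [B B0 FjB] := FB j%:Z.
  exact: bounded_op_comp (iterV_bounded j) (MFop_bounded B0 FjB).
elim/big_ind: _ => [|T S|j _]; [|exact: bounded_opD|].
  by split=> [c x y|]; [rewrite scaler0 addr0|exists 0 => x; rewrite l2norm0 mul0r].
have [B B0 FjB] := FB (- j.+1%:Z).
exact: bounded_op_comp (MFop_bounded B0 FjB) (iterVstar_bounded j.+1).
Qed.

(** Uniform in l, and stable under bounded left factors ([column_decay_comp]), which is how decay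
    passes from c to h(c) c. The clause on E_0 covers the one basis vector outside all orbits. *)
Definition column_decay (T : l2 R -> l2 R) : Prop :=
  T (ebasis R 0) = 0 /\
  forall K : nat, exists M : R, forall m l, ~~ (s%:Z %| l)%Z ->
    (1 + m%:R) ^+ K * l2norm (T (ebasis R ((s ^ m)%N%:Z * l))) <= M.

Lemma iterVstar_ebasis_low j m l : (j <= m)%N ->
  iter j (@Vstar R s) (ebasis R ((s ^ m)%N%:Z * l)) =
  ebasis R ((s ^ (m - j))%N%:Z * l).
Proof.
move=> jm; apply: l2P => k; rewrite iterVstar_val !ebasisE.
rewrite -{1}(subnKC jm) expnD PoszM -mulrA (inj_eq (mulfI _))//.
by rewrite -lt0n expn_gt0 s_gt0.
Qed.

(** A nonzero coordinate k would satisfy s^j k = s^m l with j > m, forcing s to divide l. *)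
Lemma iterVstar_ebasis_high j m l : (m < j)%N -> ~~ (s%:Z %| l)%Z ->
  iter j (@Vstar R s) (ebasis R ((s ^ m)%N%:Z * l)) = 0.
Proof.
move=> mj sl; apply: l2P => k; rewrite iterVstar_val ebasisE l20_val.
case: eqP => //; rewrite -(subnKC (ltnW mj)) expnD PoszM -mulrA => /mulfI.
rewrite -lt0n expn_gt0 s_gt0 => /(_ isT) kl; case/negP: sl.
by rewrite -kl -(prednK (n := j - m)) ?subn_gt0// expnS PoszM -mulrA dvdz_mulr.
Qed.

(** Each term equals 1/(1+j) - 1/(2+j). The case N = 0 bounds the full series by 1, general N gives
    the rate of convergence. *)
Lemma sum_telescope (N n : nat) : (N <= n)%N ->
  \sum_(N <= j < n) ((1 + j%:R) * (2 + j%:R))^-1 <= (1 + N%:R)^-1 :> R.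
Proof.
move=> Nn; apply: (@le_trans _ _ ((1 + N%:R)^-1 - (1 + n%:R)^-1)).
  rewrite le_eqVlt; apply/orP; left; apply/eqP.
  elim: n Nn => [|n IH]; first by rewrite leqn0 => /eqP ->; rewrite big_geq// subrr.
  rewrite leq_eqVlt => /predU1P[->|Nn]; first by rewrite big_geq// subrr.
  rewrite big_nat_recr//= IH// -(natr1 n).
  have n0 : (0 : R) <= n%:R by exact: ler0n.
  have N0 : (0 : R) <= N%:R by exact: ler0n.
  field; rewrite !gt_eqF//; lra.
by rewrite lerBlDr lerDl invr_ge0 addr_ge0.
Qed.

(** Two of the K + 2 powers of the weight w pay for summability in j: 2 + j <= 2 (1 + j), hence (1 +
    j)(2 + j) <= 2 w^2. The other K dominate (1 + m)^K. *)
Lemma decay_split (K m j : nat) (w a M : R) : 0 <= a ->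
  1 + m%:R <= w -> 1 + j%:R <= w -> w ^+ K.+2 * a <= M ->
  (1 + m%:R) ^+ K * a <= 2 * M * ((1 + j%:R) * (2 + j%:R))^-1.
Proof.
move=> a0 mw jw aM; have m0 : (0 : R) <= m%:R by exact: ler0n.
have j0 : (0 : R) <= j%:R by exact: ler0n.
rewrite ler_pdivlMr; last by rewrite mulr_gt0; lra.
apply: (@le_trans _ _ (2 * (w ^+ K.+2 * a))); last by rewrite ler_wpM2l.
rewrite mulrAC [leRHS]mulrA; apply: ler_wpM2r => //.
rewrite -(addn2 K) exprD [leRHS]mulrCA; apply: ler_pM.
- by rewrite exprn_ge0// addr_ge0.
- by rewrite mulr_ge0//; lra.
- by rewrite lerXn2r// nnegrE; lra.
- by nra.
Qed.

(** Each term of the series maps E_(s^m l) to a multiple of a basis vector, or to 0, so the column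
    norm is at most the sum of the moduli of the weights met by this vector. *)
Lemma Iinf_column_decay (T : l2 R -> l2 R) : bounded_op T -> Iinf s T ->
  column_decay T.
Proof.
move=> Tb [_ [F [FC FRD Fcv]]].
have FB n := C0_bounded (FC n).
have Pb N := partial_sum_bounded N FB.
have near_T := norm_cvg_near Pb Tb Fcv.
split.
  apply: l2norm0_eq0; apply/le_anti; rewrite l2norm_ge0 andbT.
  apply/ler_addgt0Pl => e e0; rewrite addr0.
  have [N _ /(_ N (leqnn N) (ebasis R 0))] := near_T e e0.
  rewrite l2norm_ebasis mulr1 partial_sumE !big1 ?addr0 ?sub0r ?l2normN//.
    move=> j _; rewrite (_ : iter _ _ _ = ebasis R 0) ?MFop_ebasis0//.
    apply: l2P => k; rewrite iterVstar_val !ebasisE.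
    by rewrite mulf_eq0 -[_ == 0 :> int]/(s ^ j.+1 == 0)%N expn_eq0 eqn0Ngt s_gt0.
  move=> j _; rewrite MFop_ebasis0.
  by apply: lin0; have [] := iterV_bounded j.
move=> K; have [M FM] := FRD K.+2.
have FM' m n t : Zadic_units t ->
    (1 + m%:R + `|n|%N%:R) ^+ K.+2 * normc (F n (m, t)) <= M.
  move=> tu; apply: le_trans (FM m n); rewrite pmulrn -abszE.
  rewrite ler_wpM2l ?exprn_ge0 ?addr_ge0//.
  have [B B0 nB] := FB n; apply: ub_le_sup; last by exists t.
  by exists B => _ [u uu <-]; exact: nB.
(* The nonnegative and the negative diagonals contribute 2 M each; the 1 pays for replacing T by a
   partial sum, whose length N may depend on m and is taken so that the error is at most (1 +
   m)^(-K). *)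
exists (4 * M + 1) => m l sl; set E := ebasis R _.
have lu : Zadic_units (int_Zadic s l) by apply/Zadic_units_int.
have p0 : 0 < (1 + m%:R) ^+ K :> R by rewrite exprn_gt0// ltr_wpDr.
have M0 : 0 <= M.
  apply: le_trans (FM' 0 0 _ lu); rewrite mulr_ge0 ?normc_ge0// exprn_ge0//.
have [N _ /(_ N (leqnn N) E)] := near_T _ (divr_gt0 ltr01 p0).
rewrite l2norm_ebasis mulr1 => TN.
have PN : (1 + m%:R) ^+ K * l2norm (partial_sum F N E) <= 4 * M.
  rewrite partial_sumE.
  apply: le_trans (ler_wpM2l (ltW p0) (l2normD _ _)) _.
  apply: le_trans (ler_wpM2l (ltW p0) (lerD (l2norm_sum _ _) (l2norm_sum _ _))) _.
  rewrite -big_split mulr_sumr /=.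
  apply: (@le_trans _ _ (\sum_(j < N) 4 * M * ((1 + j%:R) * (2 + j%:R))^-1)).
    apply: ler_sum => j _; rewrite mulrDr.
    rewrite (_ : 4 * M * _ = 2 * M * ((1 + j%:R) * (2 + j%:R))^-1 + 2 * M * ((1 + j%:R) * (2 + j%:R))^-1); last by ring.
    apply: lerD.
      apply: (@decay_split K m j (1 + m%:R + j%:R)); first exact: l2norm_ge0.
      - by rewrite lerDl.
      - by rewrite addrAC lerDl.
      rewrite iterV_norm MFop_ebasis//.
      apply: le_trans (ler_wpM2l _ (l2normZ _ _)) _.
        by rewrite exprn_ge0// addr_ge0// addr_ge0.
      by rewrite l2norm_ebasis mulr1; exact: (FM' m j%:Z).
    have [mj|jm] := ltnP m j.+1.
      rewrite -iterS iterVstar_ebasis_high// (_ : MFop _ 0 = 0); last first.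
        have [B B0 nB] := FB (- j.+1%:Z).
        by apply: lin0; have [] := MFop_bounded B0 nB.
      by rewrite l2norm0 mulr0 !mulr_ge0// invr_ge0 mulr_ge0// addr_ge0.
    apply: (@decay_split K m j (1 + m%:R)) => //; first exact: l2norm_ge0.
      by rewrite lerD2l ler_nat ltnW.
    rewrite -iterS iterVstar_ebasis_low// MFop_ebasis//.
    apply: le_trans (ler_wpM2l _ (l2normZ _ _)) _.
      by rewrite exprn_ge0// addr_ge0.
    rewrite l2norm_ebasis mulr1.
    (* On this diagonal the decay weight is 1 + (m - (j+1)) + (j+1) = 1 + m. *)
    apply: le_trans (FM' (m - j.+1)%N (- j.+1%:Z) _ lu).
    rewrite ler_wpM2r ?normc_ge0// abszN absz_nat.
    by rewrite -[1 + _ + _]addrA -natrD subnK.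
  rewrite -mulr_sumr -[leRHS]mulr1; apply: ler_wpM2l; first by rewrite mulr_ge0.
  have := @sum_telescope 0 N (leq0n N).
  by rewrite addr0 invr1 big_mkord.
have : l2norm (T E) <= l2norm (partial_sum F N E) + 1 / (1 + m%:R) ^+ K.
  rewrite -lerBlDl; apply: le_trans TN; rewrite l2normB lerBlDr.
  by rewrite -{1}[T E](subrK (partial_sum F N E)) l2normD.
move/(ler_wpM2l (ltW p0))/le_trans; apply.
by rewrite mulrDr mulrCA mulfV ?gt_eqF// mulr1 lerD2r.
Qed.

End weighted_shifts.
(** * Matrix entries of elements of HS *)

Section limits.
Variable R : realType.
Local Notation C := R[i].

Lemma normcB (a b : C) : normc (a - b) = normc (b - a).
Proof. by rewrite -opprB normcN. Qed.

Lemma normc_eq0_small (z : C) : (forall e : R, 0 < e -> normc z <= e) -> z = 0.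
Proof.
move=> ze; apply/eq0_normc/le_anti; rewrite normc_ge0 andbT.
by apply/ler_addgt0Pl => e e0; rewrite addr0 ze.
Qed.

Lemma Re_le_normc (z : C) : `|complex.Re z| <= normc z.
Proof.
by case: z => a b /=;
  rewrite -sqrtr_sqr ler_sqrt ?addr_ge0 ?sqr_ge0// lerDl sqr_ge0.
Qed.

Lemma Im_le_normc (z : C) : `|complex.Im z| <= normc z.
Proof.
by case: z => a b /=;
  rewrite -sqrtr_sqr ler_sqrt ?addr_ge0 ?sqr_ge0// lerDr sqr_ge0.
Qed.

Lemma real_cauchy_cvg (u : nat -> R) :
  (forall e : R, 0 < e -> exists N, forall n, (N <= n)%N -> `|u N - u n| < e) ->
  cvgn u.
Proof.
move=> uc; apply: cauchy_cvg; apply/cauchyP => e e0.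
by have [N NP] := uc e e0; exists (u N), N => // n /= Nn; exact: NP.
Qed.

Lemma complex_cauchy_cvg (u : nat -> C) :
  (forall e : R, 0 < e -> exists N, forall n, (N <= n)%N -> normc (u N - u n) < e) ->
  exists z : C, (u : nat -> C^o) @ \oo --> (z : C^o).
Proof.
move=> uc.
have /cvg_ex[a ua] : cvgn (fun n => complex.Re (u n)).
  apply: real_cauchy_cvg => e /uc[N NP]; exists N => n /NP.
  by apply: le_lt_trans; rewrite -raddfB Re_le_normc.
have /cvg_ex[b ub] : cvgn (fun n => complex.Im (u n)).
  apply: real_cauchy_cvg => e /uc[N NP]; exists N => n /NP.
  by apply: le_lt_trans; rewrite -raddfB Im_le_normc.
by exists (a +i* b); exact: cvgC_ReIm.
Qed.

Lemma cvg_normc_sqr (u : nat -> C) (z : C) : (u : nat -> C^o) @ \oo --> (z : C^o) ->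
  normc (u n) ^+ 2 @[n --> \oo] --> normc z ^+ 2.
Proof.
move=> /cvgCP uz; under eq_fun do rewrite expr2; rewrite expr2.
suff : normc (u n) @[n --> \oo] --> normc z by move=> h; exact: cvgM.
apply/cvgrPdist_lt => e /uz; apply: filterS => n; apply: le_lt_trans.
have h1 : normc (u n) <= normc z + normc (z - u n).
  rewrite normcB; apply: le_trans (normcD_le _ _).
  by rewrite addrC subrK.
have h2 : normc z <= normc (z - u n) + normc (u n).
  by apply: le_trans (normcD_le _ _); rewrite subrK.
by rewrite ler_norml; lra.
Qed.

(** Fatou: a box sum involves finitely many coordinates and so passes to the limit, where it keeps
    the bound B^2. *)
Lemma l2norm_fatou (u : nat -> l2 R) (x : l2 R) (B : R) : 0 <= B ->
  (forall k, (fun n => u n k : C^o) @ \oo --> (x k : C^o)) ->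
  (\forall n \near \oo, l2norm (u n) <= B) -> l2norm x <= B.
Proof.
move=> B0 ux uB; apply: l2norm_le_box => // N.
have sum_cvg (h : nat -> int) : \sum_(0 <= j < N) normc (u n (h j)) ^+ 2 @[n --> \oo] -->
    \sum_(0 <= j < N) normc (x (h j)) ^+ 2.
  elim: N => [|N IH].
    by under eq_fun do rewrite big_geq//; rewrite big_geq//; exact: cvg_cst.
  under eq_fun do rewrite big_nat_recr//=; rewrite big_nat_recr//=.
  by apply: cvgD IH _; exact: cvg_normc_sqr.
have bc : box_sum (fun l => normc (u n l) ^+ 2) N @[n --> \oo] -->
    box_sum (fun l => normc (x l) ^+ 2) N.
  by apply: cvgD; [exact: (sum_cvg Posz) | exact: (sum_cvg (fun j => - j.+1%:Z))].
rewrite -(cvg_lim _ bc)//; apply: limr_le; first exact: cvgP bc.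
apply: filterS uB => n nB; apply: le_trans (box_le_l2norm _ _) _.
by rewrite ler_pXn2r ?nnegrE ?l2norm_ge0.
Qed.

Definition tail_op (N : nat) : l2 R -> l2 R := diag_op (fun l => (N < `|l|)%N%:R).

Let tail1 N k : normc ((N < `|k|)%N%:R : C) <= 1.
Proof. by case: (_ < _)%N; rewrite ?normc1 ?normc0. Qed.

(** Pythagoras: the squared tail is |x|^2 - |h|^2, and h, supported on |l| <= N, contains the box -N
    <= l < N. *)
Lemma tail_op_cvg x (e : R) : 0 < e -> \forall N \near \oo, l2norm (tail_op N x) <= e.
Proof.
move=> e0; have /cvgrPdist_lt/(_ (e ^+ 2) (exprn_gt0 _ e0)) := @cvg_box_l2norm R x.
apply: filterS => N; set h := x - tail_op N x.
have hE k : h k = (~~ (N < `|k|)%N)%:R * x k.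
  rewrite l2D_val l2N_val (diag_val _ _ (tail1 N)).
  by case: ltnP => _; rewrite ?mul1r ?mul0r ?subrr ?subr0.
have pyth : l2norm x ^+ 2 = l2norm h ^+ 2 + l2norm (tail_op N x) ^+ 2.
  apply: (is_sumZ_unique (is_sumZ_l2norm x)).
  have := is_sumZD (is_sumZ_l2norm h) (is_sumZ_l2norm (tail_op N x)).
  congr is_sumZ; apply/funext => k; rewrite hE (diag_val _ _ (tail1 N)).
  by case: ltnP => _; rewrite !mul0r ?mul1r normc0 expr0n ?addr0 ?add0r.
have : box_sum (fun l => normc (x l) ^+ 2) N <= l2norm h ^+ 2.
  apply: le_trans (box_le_l2norm h N); apply: lerD; rewrite !big_seq;
    apply: ler_sum => n;
  rewrite mem_index_iota => /andP[_ nN]; rewrite hE.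
    by rewrite absz_nat -leqNgt (ltnW nN) mul1r.
  by rewrite abszN absz_nat -leqNgt nN mul1r.
move=> bh; move/(le_lt_trans (ler_norm _)) => lt_e.
rewrite -(@ler_pXn2r _ 2) ?nnegrE ?l2norm_ge0 ?(ltW e0)//.
lra.
Qed.

End limits.

(** * Continuity of the matrix entries within orbits and their limits at s-adic units *)

Section matrix_entries.
Variables (R : realType) (s : nat) (s_ge2 : (2 <= s)%N).
Local Notation C := R[i].
Local Notation Zs := (Zadic s).
Implicit Types (x y : l2 R) (k l : int).

Let s_gt0 : (0 < s)%N := ltnW s_ge2.

Definition entry (a : l2 R -> l2 R) (r c : nat) (l : int) : C :=
  a (ebasis R ((s ^ c)%N%:Z * l)) ((s ^ r)%N%:Z * l).

Lemma perm_op_ebasis (e : int -> int) (eK : involutive e) k :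
  perm_op e (ebasis R k) = ebasis R (e k).
Proof.
apply: l2P => j; rewrite (perm_val eK) !ebasisE.
by rewrite (can2_eq eK eK).
Qed.

(** The difference of the two entries is, up to sign, one coordinate of the commutator with the
    swap, evaluated at the unit vector E_(s^c l); hence a single J serves all r and c. *)
Lemma HS_entry_unif (a : l2 R -> l2 R) (e : R) : HS s a -> 0 < e ->
  \forall J \near \oo, forall l l', ~~ (s%:Z %| l)%Z -> ~~ (s%:Z %| l')%Z ->
    agree J (int_Zadic s l) (int_Zadic s l') ->
    forall r c, normc (entry a r c l - entry a r c l') <= e.
Proof.
move=> /(HS_swap s_ge2)[_ ac] /ac; apply: filterS => J HJ l l' sl sl' ll' r c.
have := HJ _ (ex_intro _ l (ex_intro _ l' (And4 sl sl' ll' erefl)))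
  (ebasis R ((s ^ c)%N%:Z * l)).
have eK := swapK s_ge2 sl sl'.
rewrite l2norm_ebasis mulr1 (perm_op_ebasis eK) swap_l//; apply: le_trans.
set z := (X in _ <= l2norm X).
rewrite (_ : entry a r c l - _ = - z ((s ^ r)%N%:Z * l')).
  by rewrite normcN coord_le_l2norm.
rewrite /z l2D_val l2N_val (perm_val eK) swap_r// /entry.
by rewrite opprB.
Qed.

(** The sign change fixes z, so it fixes a z, whose coordinates on the orbit of l therefore equal
    their own negatives. *)
Lemma HS_block_vanish (a : l2 R -> l2 R) l (z : l2 R) k : HS s a ->
  (forall j, prime_part s j = l -> z j = 0) -> prime_part s k = l -> a z k = 0.
Proof.
move=> aHS z0 kl; have [[al _] _] := HS_swap s_ge2 aHS.
have b1 j : normc ((-1) ^+ block_sign s l j : C) <= 1.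
  by case: (block_sign s l j); rewrite ?expr1 ?normcN normc1.
have zE : diag_op (fun k => (-1) ^+ block_sign s l k) z = z.
  apply: l2P => j; rewrite (diag_val _ _ b1) /block_sign.
  by have [/z0 ->|_] := eqVneq; rewrite ?mulr0 ?mul1r.
have := HS_block s_ge2 l z aHS; rewrite zE => /(congr1 (fun w : l2 R => w k)).
rewrite (diag_val _ _ b1) /block_sign kl eqxx expr1 mulN1r => /eqP.
rewrite -subr_eq0 opprK -mulr2n -mulr_natr mulf_eq0 pnatr_eq0 orbF.
by move/eqP.
Qed.

(** Row k of [a] is the conjugate of column k of [b]. *)
Lemma adjoint_entry (a b : l2 R -> l2 R) j k : is_adjoint a b ->
  normc (a (ebasis R j) k) <= l2norm (b (ebasis R k)).
Proof.
move=> ab; have := ab (ebasis R j) (ebasis R k).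
rewrite inner_ebasisr inner_ebasisl => ->; apply: le_trans (coord_le_l2norm _ j).
by case: (b _ j) => u v /=; rewrite sqrrN.
Qed.

Lemma HS_entry_limit (a : l2 R -> l2 R) : HS s a ->
  exists Z : nat -> nat -> Zs -> C, forall r c t, Zadic_units t ->
    forall e : R, 0 < e -> \forall J \near \oo, forall l, ~~ (s%:Z %| l)%Z ->
      agree J (int_Zadic s l) t -> normc (Z r c t - entry a r c l) <= e.
Proof.
move=> aHS.
suff H r c t : exists z : C, Zadic_units t ->
    forall e : R, 0 < e -> \forall J \near \oo, forall l, ~~ (s%:Z %| l)%Z ->
      agree J (int_Zadic s l) t -> normc (z - entry a r c l) <= e.
  have [Z ZP] := choice (fun p : nat * nat * Zs => H p.1.1 p.1.2 p.2).
  by exists (fun r c t => Z (r, c, t)) => r c t; exact: (ZP (r, c, t)).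
have [tu|ntu] := pselect (Zadic_units t); last by exists 0.
(* At least one digit is kept ([N.+1]), so that the truncation of a unit is not divisible by s. *)
have [|z uz] := @complex_cauchy_cvg R (fun N => entry a r c (truncate N.+1 t)).
  move=> e e0; have e2 : 0 < e / 2 by rewrite divr_gt0.
  have [N _ NP] := HS_entry_unif aHS e2; exists N => n Nn.
  apply: le_lt_trans (_ : e / 2 < e); last by rewrite ltr_pdivrMr// ltr_pMr// ltr1n.
  apply: (NP N (leqnn N)); try exact: truncate_unit.
  apply: (@agree_trans _ _ _ t);
    first exact: (agree_le (leqnSn N) (agree_truncate s_ge2 t)).
  by apply: agree_sym; exact: (agree_le (leqW Nn) (agree_truncate s_ge2 t)).
exists z => _ e e0; have e2 : 0 < e / 2 by rewrite divr_gt0.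
have /cvgCP/(_ _ e2)[N _ NP] := uz.
have := HS_entry_unif aHS e2; apply: filterS => J HJ l sl lt.
pose n := maxn N J; have nP := NP n (leq_maxl N J).
rewrite [e]splitr (_ : _ - _ = (z - entry a r c (truncate n.+1 t)) +
  (entry a r c (truncate n.+1 t) - entry a r c l)); last by rewrite addrA subrK.
apply: le_trans (normcD_le _ _) _; apply: lerD; first exact: ltW.
apply: HJ => //; first exact: truncate_unit.
apply: (@agree_trans _ _ _ t); last exact: agree_sym.
exact: (agree_le (leqW (leq_maxr N J)) (agree_truncate s_ge2 t)).
Qed.

End matrix_entries.
(** * Operators with decaying columns and rows *)

Section decaying_operators.
Variables (R : realType) (s : nat) (s_ge2 : (2 <= s)%N).
Local Notation C := R[i].
Local Notation Zs := (Zadic s).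
Implicit Types (x y : l2 R) (k l : int) (t : Zs).

Let s_gt0 : (0 < s)%N := ltnW s_ge2.

Lemma approx_Zadic_unit t (J : nat) : Zadic_units t ->
  exists2 l, ~~ (s%:Z %| l)%Z & agree J (int_Zadic s l) t.
Proof.
move=> tu; exists (truncate J.+1 t)%:Z; first exact: truncate_unit.
exact: (agree_le (leqnSn J) (agree_truncate s_ge2 t)).
Qed.

(* The n-th summand maps the m-th weight to the entry in row diag_row n m and
   column diag_col n m: V^n M_F maps E_(s^m l) to a multiple of E_(s^(m+n) l),
   and M_F (V^* )^|n| maps E_(s^(m+|n|) l) to a multiple of E_(s^m l). *)
Definition diag_row (n : int) (m : nat) : nat := if n is Posz n' then (m + n')%N else m.
Definition diag_col (n : int) (m : nat) : nat := if n is Negz n' then (m + n'.+1)%N else m.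

(** Turns decay of the entries in max (row, column) into the weight m + |n| of [rapid_decay]. *)
Lemma max_row_col n m : maxn (diag_row n m) (diag_col n m) = (m + `|n|)%N.
Proof. by case: n => n /=; [rewrite maxnC|]; apply/maxn_idPr; rewrite leq_addr. Qed.

Variables a b : l2 R -> l2 R.
Hypotheses (aHS : HS s a) (ab : is_adjoint a b).
Hypotheses (a_decay : column_decay s a) (b_decay : column_decay s b).

Let a_bounded : bounded_op a. Proof. by have [] := HS_swap s_ge2 aHS. Qed.

(** If the column index is the larger one, the entry is bounded by a column of [a]; otherwise by a
    column of the adjoint [b]. *)
Lemma entry_decay (K : nat) : exists M : R, forall r c l, ~~ (s%:Z %| l)%Z ->
  (1 + (maxn r c)%:R) ^+ K * normc (entry s a r c l) <= M.
Proof.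
have [_ /(_ K)[Ma aM]] := a_decay; have [_ /(_ K)[Mb bM]] := b_decay.
exists (`|Ma| + `|Mb|) => r c l sl; have [rc|cr] := leqP r c.
  apply: le_trans (ler_wpDr (normr_ge0 Mb) (ler_norm Ma)).
  apply: le_trans (aM c l sl); rewrite ler_wpM2l ?exprn_ge0 ?addr_ge0//.
  exact: coord_le_l2norm.
apply: le_trans (ler_wpDl (normr_ge0 Ma) (ler_norm Mb)).
apply: le_trans (bM r l sl); rewrite ler_wpM2l ?exprn_ge0 ?addr_ge0//.
exact: adjoint_entry.
Qed.

Variable Z : nat -> nat -> Zs -> C.
Hypothesis ZP : forall r c t, Zadic_units t ->
  forall e : R, 0 < e -> \forall J \near \oo, forall l, ~~ (s%:Z %| l)%Z ->
    agree J (int_Zadic s l) t -> normc (Z r c t - entry s a r c l) <= e.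

Lemma lim_entry_int r c l : ~~ (s%:Z %| l)%Z -> Z r c (int_Zadic s l) = entry s a r c l.
Proof.
move=> sl; apply/eqP; rewrite -subr_eq0; apply/eqP/normc_eq0_small => e e0.
have lu : Zadic_units (int_Zadic s l) by apply/Zadic_units_int.
by have [J _ /(_ J (leqnn J) l sl)] := ZP r c lu e0; apply.
Qed.

Lemma lim_entry_bound r c t (w B : R) : Zadic_units t -> 0 <= w ->
  (forall l, ~~ (s%:Z %| l)%Z -> w * normc (entry s a r c l) <= B) ->
  w * normc (Z r c t) <= B.
Proof.
move=> tu w0 lB; apply/ler_addgt0Pr => e e0.
have w1 : 0 < w + 1 by rewrite ltr_wpDl.
have [J _ /(_ J (leqnn J)) JP] := ZP r c tu (divr_gt0 e0 w1).
have [l sl lt] := approx_Zadic_unit J tu.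
have := JP l sl lt; rewrite ler_pdivlMr// => He.
have : normc (Z r c t) <= normc (Z r c t - entry s a r c l) + normc (entry s a r c l).
  by apply: le_trans (normcD_le _ _); rewrite subrK.
move/(ler_wpM2l w0)/le_trans; apply; rewrite mulrDr addrC lerD ?lB//.
by apply: le_trans He; rewrite mulrC ler_wpM2l ?normc_ge0// lerDl.
Qed.

(** J depends on t alone; the comparison integer l is chosen afterwards, close enough to t' for both
    limits to be approximated. *)
Lemma lim_entry_unif r c t (e : R) : Zadic_units t -> 0 < e ->
  exists J, forall t', Zadic_units t' -> agree J t t' ->
    normc (Z r c t - Z r c t') <= e.
Proof.
move=> tu e0; have e2 : 0 < e / 2 by rewrite divr_gt0.
have [J _ /(_ J (leqnn J)) JP] := ZP r c tu e2.
exists J => t' tu' tt'.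
have [J' _ /(_ (maxn J J') (leq_maxr _ _)) JP'] := ZP r c tu' e2.
have [l sl lt'] := approx_Zadic_unit (maxn J J') tu'.
rewrite [e]splitr (_ : _ - _ = (Z r c t - entry s a r c l) -
  (Z r c t' - entry s a r c l)); last by ring.
apply: le_trans (normcD_le _ _) _; rewrite normcN; apply: lerD; last exact: JP'.
apply: JP => //; apply: (@agree_trans _ _ _ t'); last exact: agree_sym.
exact: (agree_le (leq_maxl J J') lt').
Qed.

Definition symbol (n : int) (p : nat * Zs) : C :=
  Z (diag_row n p.1) (diag_col n p.1) p.2.

Lemma symbol_decay (K : nat) : exists2 M : R, 0 <= M & forall n m t, Zadic_units t ->
  (1 + m%:R + `|n|%N%:R) ^+ K * normc (symbol n (m, t)) <= M.
Proof.
have [M MP] := entry_decay K; exists `|M| => // n m t tu.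
apply: lim_entry_bound => // l sl.
apply: le_trans (ler_norm M);
  apply: le_trans (MP (diag_row n m) (diag_col n m) l sl).
by rewrite max_row_col natrD addrA.
Qed.

Lemma symbol_C0 n : C0 (symbol n).
Proof.
split.
  apply/subspace_continuousP => -[m t] tu; apply/cvgCP => e e0.
  have e2 : 0 < e / 2 by rewrite divr_gt0.
  have [J JP] := lim_entry_unif (diag_row n m) (diag_col n m) tu e2.
  rewrite near_withinE.
  exists ([set m], agree J t); first by split;
    [exact: discrete_set1|exact: nbhs_agree].
  move=> [m' t'] /= [-> tt'] tu'; rewrite /from_subspace /symbol /=.
  apply: le_lt_trans (JP t' tu' tt') _.
  by rewrite ltr_pdivrMr// ltr_pMr// ltr1n.
move=> e e0; have [M M0 MP] := symbol_decay 1.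
have Me : 0 <= M / e by rewrite divr_ge0// ltW.
have [m0 m0P] : exists m0 : nat, M / e < m0%:R.
  by exists (Num.bound (M / e)); rewrite archi_boundP.
(* Where m >= m0 > M / e, the first power of the weight 1 + m already pushes the symbol below e. *)
exists (`I_m0 `*` @Zadic_units s); split.
- by apply: compact_setX;
  [exact: finite_compact (finite_II m0)|exact: compact_Zadic_units].
- by move=> [m t] [].
move=> [m t] tu nK; have m0m : (m0 <= m)%N.
  by rewrite leqNgt; apply/negP => mm0; apply: nK.
have := MP n m t tu; rewrite expr1 => MPn.
rewrite ltNge; apply/negP => eZ.
have : (1 + m%:R) * e <= M.
  by apply: le_trans MPn; apply: ler_pM; rewrite ?addr_ge0 ?(ltW e0) ?lerDl.
apply/negP; rewrite -ltNge -ltr_pdivrMr//; apply: lt_le_trans m0P _.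
by rewrite ler_wpDl// ler_nat.
Qed.

Lemma symbol_rapid_decay : rapid_decay (fun m n =>
  sup [set normc (symbol n (m, x)) | x in @Zadic_units s]).
Proof.
move=> K; have [M M0 MP] := symbol_decay K; exists M => m n.
have w0 : 0 < (1 + m%:R + `|n|%:~R) ^+ K :> R.
  by rewrite exprn_gt0// -addrA ltr_wpDr// addr_ge0.
rewrite mulrC -ler_pdivlMr//; apply: ge_sup.
  (* The integer 1 is a unit, so the supremum is over a nonempty set. *)
  have u1 : Zadic_units (int_Zadic s 1).
    by apply/Zadic_units_int => //; rewrite dvdz1 absz_nat neq_ltn s_ge2 orbT.
  by exists (normc (symbol n (m, int_Zadic s 1))), (int_Zadic s 1).
move=> _ [t tu <-]; rewrite ler_pdivlMr// mulrC.
by apply: le_trans (MP n m t tu); rewrite pmulrn -abszE.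
Qed.

Let symbol_bounded n : exists2 B : R, 0 <= B &
  forall m t, Zadic_units t -> normc (symbol n (m, t)) <= B.
Proof. exact: C0_bounded (symbol_C0 n). Qed.

(** Decay of order 2 makes the norms of the terms summable. The diagonals j and -(j+1) are grouped,
    each bounded by 2 M times the telescoping term, whence 4 M. *)
Lemma partial_sum_tail : exists2 M : R, 0 <= M & forall N K x, (N <= K)%N ->
  l2norm (partial_sum symbol K x - partial_sum symbol N x) <=
    M * (1 + N%:R)^-1 * l2norm x.
Proof.
have [M M0 MP] := symbol_decay 2; exists (4 * M) => [|N K x NK];
  first by rewrite mulr_ge0.
have bnd n j m t : (j <= `|n|)%N -> Zadic_units t ->
    normc (symbol n (m, t)) <= 2 * M * ((1 + j%:R) * (2 + j%:R))^-1.
  move=> jn tu; rewrite -[leLHS]mul1r -[X in X * _](expr0 (1 + 0%:R)).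
  apply: (@decay_split R 0 0 j (1 + m%:R + `|n|%N%:R)); first exact: normc_ge0.
  - by rewrite addr0 -addrA lerDl addr_ge0.
  - by rewrite addrAC ler_wpDr// lerD2l ler_nat.
  - exact: MP.
pose B (j : nat) := 2 * M * ((1 + j%:R) * (2 + j%:R))^-1 : R.
have B0 j : 0 <= B j by rewrite !mulr_ge0// invr_ge0 mulr_ge0// addr_ge0.
pose G (j : nat) := iter j (@V R s) (MFop (symbol j%:Z) x) +
  MFop (symbol (- j.+1%:Z)) (iter j.+1 (@Vstar R s) x).
have PE n : partial_sum symbol n x = \sum_(0 <= j < n) G j.
  by rewrite partial_sumE -big_split big_mkord.
rewrite !PE (big_cat_nat (leq0n N) NK)/= addrAC subrr add0r.
apply: le_trans (l2norm_sum _ _) _.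
apply: (@le_trans _ _ (\sum_(N <= j < K) 4 * M * ((1 + j%:R) * (2 + j%:R))^-1 * l2norm x)).
  apply: ler_sum => j _.
  rewrite (_ : 4 * M * _ * _ = B j * l2norm x + B j * l2norm x);
    last by rewrite /B; ring.
  apply: le_trans (l2normD _ _) _; apply: lerD.
    by rewrite (iterV_norm s_ge2); apply: MFop_norm => // m t; exact: bnd.
  apply: (@le_trans _ _ (B j * l2norm (iter j.+1 (@Vstar R s) x))).
    by apply: MFop_norm => // m t; apply: bnd; rewrite abszN absz_nat.
  by rewrite ler_wpM2l// (iterVstar_norm s_ge2).
rewrite -mulr_suml -mulr_sumr ler_wpM2r ?l2norm_ge0// ler_wpM2l ?mulr_ge0//.
exact: sum_telescope.
Qed.

Lemma iterV_pow j v l (y : l2 R) :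
  ~~ (s%:Z %| l)%Z ->
  iter j (@V R s) y ((s ^ v)%N%:Z * l) =
  if (j <= v)%N then y ((s ^ (v - j))%N%:Z * l) else 0.
Proof.
move=> sl; rewrite (iterV_val s_ge2).
have pos n : (s ^ n)%N%:Z != 0 by rewrite -lt0n expn_gt0 s_gt0.
have [jv|vj] := leqP j v.
  rewrite (_ : (s ^ v)%N%:Z * l = (s ^ j)%N%:Z * ((s ^ (v - j))%N%:Z * l)).
    by rewrite dvdz_mulr// mulKz.
  by rewrite mulrA -PoszM -expnD subnKC.
rewrite ifF//; apply: contraNF sl.
rewrite (_ : (s ^ j)%N%:Z = (s ^ v)%N%:Z * (s * s ^ (j - v).-1)%N%:Z).
  by rewrite dvdz_mul2l// PoszM; apply: dvdz_trans; exact: dvdz_mulr.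
by rewrite -expnS prednK ?subn_gt0// -PoszM -expnD subnKC// ltnW.
Qed.

(** In row s^v l, the diagonals 0 <= j <= v reach the columns v, ..., 0 and the N negative diagonals
    the columns v + 1, ..., v + N. The condition v < N makes all the former present. *)
Lemma symbol_row_val v l N x : ~~ (s%:Z %| l)%Z -> (v < N)%N ->
  partial_sum symbol N x ((s ^ v)%N%:Z * l) =
  \sum_(0 <= q < v.+1 + N) entry s a v q l * x ((s ^ q)%N%:Z * l).
Proof.
move=> sl vN; set k := _ * l.
have lu : Zadic_units (int_Zadic s l) by apply/Zadic_units_int.
have sum_val (u : 'I_N -> l2 R) : (\sum_(j < N) u j) k = \sum_(j < N) u j k.
  by elim/big_rec2: _ => [|j y z _ <-].
have coef n m y : MFop (symbol n) y ((s ^ m)%N%:Z * l) =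
    entry s a (diag_row n m) (diag_col n m) l * y ((s ^ m)%N%:Z * l).
  have [B B0 nB] := symbol_bounded n; rewrite (MFop_val s_ge2 _ _ B0 nB).
  rewrite /MF_coef ifF; last first.
    apply/negbTE; rewrite mulf_neq0//; first by rewrite -lt0n expn_gt0 s_gt0.
    by apply: contraNneq sl => ->; rewrite dvdz0.
  by rewrite prime_part_pow// vals_pow// /symbol lim_entry_int.
rewrite partial_sumE l2D_val !sum_val.
rewrite (big_cat_nat (leq0n v.+1) (leq_addr _ _))/=; congr (_ + _).
  (* Diagonal j reads column v - j, so the order is reversed; for j > v the vector V^j y has no
     component in row v. *)
  rewrite big_nat_rev/= -(big_mkord xpredT (fun j : nat => iter j (@V R s) (MFop (symbol j%:Z) x) k)).
  rewrite (big_cat_nat (leq0n v.+1) vN)/= [X in _ + X]big_nat_cond [X in _ + X]big1 ?addr0; last first.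
    by move=> j /andP[/andP[vj _] _]; rewrite (iterV_pow _ _ _ sl) leqNgt vj.
  apply: eq_big_nat => j /andP[_ jv].
  rewrite (iterV_pow _ _ _ sl) -ltnS jv coef/= add0n subSS subnK//.
rewrite -[v.+1 in RHS]add0n big_addn add0n addKn big_mkord; apply: eq_bigr => j _.
have -> : (j + v.+1 = v + j.+1)%N by rewrite addnC addSnnS.
rewrite -iterS (coef (- j.+1%:Z)) (iterVstar_val s_ge2) mulrA -PoszM -expnD.
by rewrite [(j.+1 + v)%N]addnC.
Qed.

(** Cut x to the orbit of k and split it into a finite part y and a far part z. The partial sum
    computes a y at k exactly, the rest of x does not reach k because orbits are preserved, and a z
    is small because z is a tail. *)
Lemma partial_sum_coord x k :
  (fun N => partial_sum symbol N x k : C^o) @ \oo --> (a x k : C^o).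
Proof.
have [k0|/(int_decomp s_ge2)[v [l [sl kE]]]] := eqVneq k 0.
  (* Row 0 of [a] is zero because the adjoint kills E_0; every term of the series vanishes at
     coordinate 0 as well. *)
  rewrite (_ : a x k = 0); last first.
    by rewrite k0 -inner_ebasisr ab; have [-> _] := b_decay; rewrite inner0r.
  rewrite (_ : (fun N => _) = fun=> 0 : C^o); first exact: cvg_cst.
  apply/funext => N; rewrite partial_sumE l2D_val.
  have sum_val (u : 'I_N -> l2 R) : (\sum_(j < N) u j) k = \sum_(j < N) u j k.
    by elim/big_rec2: _ => [|j y z _ <-].
  have coef0 n y : MFop (symbol n) y 0 = 0.
    have [B B0 nB] := symbol_bounded n; rewrite (MFop_val s_ge2 _ _ B0 nB).
    by rewrite /MF_coef eqxx mul0r.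
  rewrite !sum_val k0 big1 => [|j _]; last first.
    by rewrite (iterV_val s_ge2) dvdz0 div0z coef0.
  by rewrite add0r big1// => j _; exact: coef0.
have l0 : l != 0 by apply: contraNneq sl => ->; rewrite dvdz0.
have [M M0 aM] := bounded_ex a_bounded.
apply/cvgCP => e e0.
have eM : 0 < e / 2 / M by rewrite !divr_gt0.
near=> N; have vN : (v < N)%N by near: N; exact: nbhs_infty_gt.
pose c (j : int) : C := ((prime_part s j == l) && (v.+1 + N <= vals s j)%N)%:R.
have c1 j : normc (c j) <= 1 by rewrite /c; case: (_ && _); rewrite ?normc1 ?normc0.
pose z := diag_op c x.
pose y := \sum_(0 <= q < v.+1 + N) x ((s ^ q)%N%:Z * l) *: ebasis R ((s ^ q)%N%:Z * l).
have [al _] := a_bounded.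
have pos n : (s ^ n)%N%:Z != 0 by rewrite -lt0n expn_gt0 s_gt0.
have ay : a y k = partial_sum symbol N x k.
  rewrite kE (symbol_row_val _ sl vN) /y; move: (v.+1 + N)%N => n.
  elim: n => [|n IH]; first by rewrite !big_geq// (lin0 al).
  rewrite !big_nat_recr//= (linD _ _ al) (linZ _ _ al) l2D_val IH l2Z_val.
  by rewrite mulrC.
have yE q : y ((s ^ q)%N%:Z * l) = if (q < v.+1 + N)%N then x ((s ^ q)%N%:Z * l) else 0.
  rewrite /y; move: (v.+1 + N)%N => n.
  elim: n => [|n IH]; first by rewrite big_geq.
  rewrite big_nat_recr// [LHS]l2D_val IH l2Z_val ebasisE (inj_eq (mulIf l0)) eqz_nat.
  rewrite (inj_eq (expnI s_ge2)) ltnS [(q <= n)%N]leq_eqVlt.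
  by have [->|_] := eqVneq; rewrite ?ltnn ?add0r ?mulr1 ?mulr0 ?addr0.
have zE q : z ((s ^ q)%N%:Z * l) = if (q < v.+1 + N)%N then 0 else x ((s ^ q)%N%:Z * l).
  rewrite (diag_val _ _ c1) /c prime_part_pow// vals_pow// eqxx /= leqNgt.
  by case: ltnP => _; rewrite ?mul0r ?mul1r.
have wz : a (x - (y + z)) k = 0.
  apply: (HS_block_vanish s_ge2 aHS (l := l)); last by rewrite kE prime_part_pow.
  move=> j jl; have j0 : j != 0.
    by apply: contraNneq l0 => j0; rewrite -jl j0 prime_part0.
  have [q [l' [sl' jE]]] := int_decomp s_ge2 j0.
  have ll' : l' = l by rewrite -jl jE prime_part_pow.
  rewrite jE ll' l2D_val l2N_val l2D_val yE zE.
  by case: ifP => _; rewrite ?addr0 ?add0r subrr.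
have -> : a x k - partial_sum symbol N x k = a z k.
  rewrite -ay; apply/eqP; rewrite subr_eq -l2D_val -(linD _ _ al) addrC.
  by rewrite -subr_eq0 -l2N_val -l2D_val -(linB _ _ al) wz.
apply: le_lt_trans (coord_le_l2norm _ _) _.
apply: le_lt_trans (aM _) _; rewrite -ltr_pdivlMl//.
apply: (@le_lt_trans _ _ (e / 2 / M)); last first.
  by rewrite [ltRHS]mulrC ltr_pM2r ?invr_gt0// ltr_pdivrMr// ltr_pMr// ltr1n.
apply: (@le_trans _ _ (l2norm (tail_op N x))); last first.
  by near: N; exact: tail_op_cvg.
apply: ler_l2norm => j;
  rewrite (diag_val _ _ c1) [tail_op N x j](diag_val (M := 1)); last first.
  by move=> i; case: (_ < _)%N; rewrite ?normc1 ?normc0.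
rewrite /c; case: andP => [[/eqP jl vj]|_]; last by rewrite mul0r normc0 normc_ge0.
have j0 : j != 0 by apply: contraNneq l0 => j0; rewrite -jl j0 prime_part0.
have [q [l' [sl' jE]]] := int_decomp s_ge2 j0.
move: vj; rewrite jE vals_pow// => Nq.
rewrite (_ : (N < _)%N = true)//.
(* The far part of the orbit lies in the tail: |s^q l'| >= s^q > q >= N. *)
apply: (leq_trans _ (_ : (s ^ q <= _)%N)).
  apply: leq_ltn_trans (ltn_expl q s_ge2).
  by apply: leq_trans Nq; rewrite leq_addl.
rewrite abszM absz_nat leq_pmulr// absz_gt0.
by apply: contraNneq sl' => ->; rewrite dvdz0.
Unshelve. all: by end_near. Qed.

(** The Cauchy estimate bounds P_K x - P_N x for all K >= N; letting K grow, Fatou and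
    coordinatewise convergence transfer the bound to a x - P_N x, uniformly over x in the unit
    ball. *)
Lemma decaying_Iinf : Iinf s a.
Proof.
split => //; exists symbol; split; [exact: symbol_C0|exact: symbol_rapid_decay|].
have [M M0 MP] := partial_sum_tail.
have Pb N := partial_sum_bounded s_ge2 N symbol_bounded.
have aP N x : l2norm (partial_sum symbol N x - a x) <= M * (1 + N%:R)^-1 * l2norm x.
  rewrite l2normB; apply: (l2norm_fatou (u := fun K => partial_sum symbol K x - partial_sum symbol N x)).
  - by rewrite !mulr_ge0 ?l2norm_ge0// invr_ge0 addr_ge0.
  - move=> k; rewrite l2D_val l2N_val; apply: cvgB; last exact: cvg_cst.
    exact: partial_sum_coord.
  - by exists N => // K /= NK; exact: MP.
apply/cvgrPdist_le => e e0; near=> N.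
rewrite sub0r normrN ger0_norm; last by apply/opnorm_ge0/bounded_opB.
have N0 : 0 < 1 + N%:R :> R by rewrite ltr_wpDr.
apply: (@le_trans _ _ (M * (1 + N%:R)^-1)).
  apply: opnorm_le; first by rewrite mulr_ge0// invr_ge0 ltW.
  exact: aP.
rewrite ler_pdivrMr// -ler_pdivrMl// mulrC ler_wpDl//.
near: N; exact: nbhs_infty_ger.
Unshelve. all: by end_near. Qed.

End decaying_operators.
(** * The theorem *)

Section slope.
Variable R : realType.
Local Notation C := R[i].

(** The real and imaginary parts of h are built this way. The value at 0 matters for continuity; in
    the product with t it is multiplied by 0. *)
Definition slope0 (g : R -> R) (t : R) : R := if t == 0 then 'D_1 g 0 else t^-1 * g t.

Lemma slope0_mul (g : R -> R) t : g 0 = 0 -> slope0 g t * t = g t.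
Proof.
move=> g0; rewrite /slope0; have [->|t0] := eqVneq; first by rewrite mulr0 g0.
by rewrite mulrAC mulVf// mul1r.
Qed.

Lemma derivable_continuous (g : R -> R) t : derivable g t 1 -> {for t, continuous g}.
Proof. by move=> /derivable1_diffP/differentiable_continuous. Qed.

(** At 0, convergence on the punctured neighborhood is the very definition of the derivative, since
    g 0 = 0; elsewhere it is a quotient of continuous functions. *)
Lemma slope0_continuous (g : R -> R) t : g 0 = 0 -> derivable g t 1 ->
  {for t, continuous (slope0 g)}.
Proof.
move=> g0 gd; have [t0|t0] := eqVneq t 0.
  rewrite t0 in gd *; apply/continuous_withinNx.
  rewrite {2}/slope0 eqxx.
  apply: cvg_trans (gd : (_ @ 0^') --> 'D_1 g 0).
  apply: near_eq_cvg; near=> u.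
  have u0 : u != 0 by near: u; exact: nbhs_dnbhs_neq.
  by rewrite /slope0 (negbTE u0) /= g0 subr0 addr0 /GRing.scale /= mulr1.
have H : (fun u => u^-1 * g u) @ t --> slope0 g t.
  rewrite /slope0 (negbTE t0); apply: cvgM; last exact: derivable_continuous.
  by apply: cvgV => //; exact: cvg_id.
apply: cvg_trans H; apply: near_eq_cvg; near=> u.
have u0 : u != 0 by near: u; apply: (cvgr_neq0 _ _ t0); exact: cvg_id.
by rewrite /slope0 (negbTE u0).
Unshelve. all: by end_near. Qed.

Lemma within_continuousC (S : set R) (f : R -> C) :
  (forall t, S t -> {for t, continuous (fun u => complex.Re (f u))}) ->
  (forall t, S t -> {for t, continuous (fun u => complex.Im (f u))}) ->
  {within S, continuous (f : R -> C^o)}.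
Proof.
move=> fr fi; apply/subspace_continuousP => t St.
apply: (cvg_trans (G := f @ nbhs t)); first by apply: cvg_app; exact: cvg_within.
have ftE : complex.Re (f t) +i* complex.Im (f t) = f t by case: (f t).
by have := cvgC_ReIm (nbhs_filter t) (fr t St) (fi t St); rewrite ftE.
Qed.

End slope.

Section closure.
Variables (R : realType) (s : nat) (s_ge2 : (2 <= s)%N).

Lemma HS_bounded (T : l2 R -> l2 R) : HS s T -> bounded_op T.
Proof. by move=> /(HS_swap s_ge2)[]. Qed.

Lemma column_decay_comp (T S : l2 R -> l2 R) : bounded_op T ->
  column_decay s S -> column_decay s (T \o S).
Proof.
move=> Tb [S0 SK]; have [Tl _] := Tb; have [M M0 TM] := bounded_ex Tb.
split=> [|K]; first by rewrite /= S0 (lin0 Tl).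
have [N SN] := SK K; exists (M * N) => m l sl /=.
apply: le_trans (ler_wpM2l _ (TM _)) _; first by rewrite exprn_ge0// addr_ge0.
by rewrite mulrCA ler_wpM2l ?(ltW M0)// SN.
Qed.

Lemma HS_column_decay_Iinf (a b : l2 R -> l2 R) : HS s a -> is_adjoint a b ->
  column_decay s a -> column_decay s b -> Iinf s a.
Proof.
move=> aHS ab ad bd; have [Z ZP] := HS_entry_limit s_ge2 aHS.
exact: decaying_Iinf ab ad bd _ ZP.
Qed.

End closure.

Theorem theorem3p7 (R : realType) (s : nat) (s_ge2 : (2 <= s)%N)
    (c : l2 R -> l2 R) (cI : Iinf s c) (c_sa : is_adjoint c c)
    (U : set R) (f : R -> R[i])
    (Uopen : open U) (Uspec : real_spectrum s c `<=` U)
    (fsmooth : smooth_on U f) (f0 : f 0 = 0)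
    (Phi : (R -> R[i]) -> l2 R -> l2 R) (Phi_cfc : is_cfc s c Phi) :
  Iinf s (Phi f).
Proof.
have c_decay : column_decay s c.
  by apply: Iinf_column_decay => //; apply: (HS_bounded s_ge2); have [] := cI.
pose qr := slope0 (fun t => complex.Re (f t)).
pose qi := slope0 (fun t => complex.Im (f t)).
have qrE t : qr t * t = complex.Re (f t) by apply: slope0_mul; rewrite f0.
have qiE t : qi t * t = complex.Im (f t) by apply: slope0_mul; rewrite f0.
have fc t : real_spectrum s c t -> {for t, continuous (fun u => complex.Re (f u))} /\
    {for t, continuous (fun u => complex.Im (f u))}.
  (* [derive1n 0] is the function itself, so the instance n = 0 of smoothness gives
     differentiability on U. *)
  by move=> /Uspec/(fsmooth 0%N)[fr fi]; split; exact: derivable_continuous.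
have qc t : real_spectrum s c t -> {for t, continuous qr} /\ {for t, continuous qi}.
  move=> /Uspec/(fsmooth 0%N)[fr fi].
  by split; apply: slope0_continuous => //; rewrite f0.
have fcont : {within real_spectrum s c, continuous (f : R -> R[i]^o)}.
  by apply: within_continuousC => t /fc[].
pose h t := qr t +i* qi t.
have hcont : {within real_spectrum s c, continuous (h : R -> R[i]^o)}.
  by apply: within_continuousC => t /qc[].
have hbcont : {within real_spectrum s c, continuous ((fun t => (h t)^*) : R -> R[i]^o)}.
  by apply: within_continuousC => t /qc[// _ qit]; exact: continuousN.
have idcont : {within real_spectrum s c, continuous ((fun t => t%:C) : R -> R[i]^o)}.
  apply: within_continuousC => t _; first exact: cvg_id.
  exact: cvg_cst.
have fE : f = fun t => h t * t%:C.
  apply/funext => t; rewrite /h; move: (qrE t) (qiE t).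
  by case: (f t) => u v /= <- <-; congr (_ +i* _); ring.
(* Conjugation leaves the real factor t alone, so f(c) and its adjoint both have c as right
   factor. *)
have fbE : (fun t => (f t)^*) = fun t => (h t)^* * t%:C.
  by apply/funext => t; rewrite fE rmorphM; congr (_ * _); rewrite /= oppr0.
have PhiE : Phi f = Phi h \o c.
  by rewrite {1}fE (cfc_mul Phi_cfc)// (cfc_id Phi_cfc).
have PhibE : Phi (fun t => (f t)^*) = Phi (fun t => (h t)^*) \o c.
  by rewrite fbE (cfc_mul Phi_cfc)// (cfc_id Phi_cfc).
apply: (HS_column_decay_Iinf s_ge2 (b := Phi (fun t => (f t)^*))).
- exact: cfc_HS Phi_cfc _ fcont.
- exact: cfc_adjoint Phi_cfc _ fcont.
- rewrite PhiE; apply: column_decay_comp => //.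
  by apply: (HS_bounded s_ge2); exact: cfc_HS Phi_cfc _ hcont.
- rewrite PhibE; apply: column_decay_comp => //.
  by apply: (HS_bounded s_ge2); exact: cfc_HS Phi_cfc _ hbcont.
Qed.
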